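(* Let $\mathcal F$ be a filter on $\omega$ which is homogeneous and isomorphic to $\mathcal F\times\omega$, and which satisfies: whenever $f:\omega\to\omega$ is unbounded on every $F\in\mathcal F$, there is some $A\in\mathcal F^+$ such that $f\restriction A$ is finite-to-one. Let $T_\alpha$ ($\alpha$ an ordinal) be the spaces associated with $\mathcal F$. Then $T_\alpha$ is a countable $\alpha$-Toronto space for every $\alpha<\omega_1$, and (for $\alpha<\omega_1$) any subspace of $T_\alpha$ of rank $\beta<\alpha$ is homeomorphic to a topological sum of countably many copies of $T_\beta$.
   Context: Filters are proper. Filters $\mathcal F$ on $A$ and $\mathcal G$ on $B$ are isomorphic if some bijection $t:A\to B$ satisfies $S\in\mathcal F\iff t(S)\in\mathcal G$ for all $S\subset A$. For a filter $\mathcal F$ on $\omega$, $\mathcal F^+$ is the family of all $X\subset\omega$ meeting every $F\in\mathcal F$; $\mathcal F\restriction X=\{F\cap X:F\in\mathcal F\}$. $\mathcal F$ is homogeneous if $\mathcal F\restriction X$ is isomorphic to $\mathcal F$ for every $X\in\mathcal F^+$. $\mathcal F\times\omega$ is the filter on $\omega\times\omega$ generated by the sets $F\times\omega$, $F\in\mathcal F$. For disjoint spaces $X_n$ ($n\in\omega$), $(X_n)_{n\in\omega}\cup_{\mathcal F}\{\infty\}$ denotes the space on the set $\{\infty\}\cup\bigcup_n X_n$ in which each $X_n$ is a clopen subspace and a neighborhood base at $\infty$ consists of the sets $\{\infty\}\cup\bigcup_{n\in F}X_n$, $F\in\mathcal F$. The spaces $T_\alpha$: $T_0=\emptyset$,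 $T_1$ is a one-point space, $T_{\alpha+1}=(\{n\}\times T_\alpha)_{n\in\omega}\cup_{\mathcal F}\{\infty\}$, and $T_\alpha=\bigoplus_{\beta<\alpha}T_\beta$ (topological sum) for limit $\alpha$. For a space $X$: $X^0=X$, $X^{\alpha+1}$ is the set of non-isolated points of $X^\alpha$, $X^\alpha=\bigcap_{\beta<\alpha}X^\beta$ for limit $\alpha$. $X$ is scattered if some $X^\alpha=\emptyset$; the least such $\alpha$ is the rank $r(X)$. $X$ is $\alpha$-Toronto if it is scattered of rank $\alpha$ and homeomorphic to each of its subspaces of rank $\alpha$. ''Countably many'' means finitely many or countably infinitely many. *)

(* Defs.v *)
From HB Require Import structures.
From mathcomp Require Import all_boot all_order.
From mathcomp Require Import all_classical.
From mathcomp Require Import topology.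
Set Implicit Arguments.
Unset Strict Implicit.
Unset Printing Implicit Defensive.
Import Order.TTheory.
Local Open Scope classical_set_scope.

(* A filter on a subset A of an ambient type is a family of subsets of A. *)
Definition filter_iso {T U : Type} (A : set T) (F : set_system T)
    (B : set U) (G : set_system U) : Prop :=
  exists t : T -> U, set_bij A B t /\
    forall S : set T, S `<=` A -> (F S <-> G (t @` S)).

Definition positive {T : Type} (F : set_system T) : set_system T :=
  [set X | forall A, F A -> X `&` A !=set0].

Definition filter_restr {T : Type} (F : set_system T) (X : set T) :
    set_system T :=
  [set A `&` X | A in F].

Definition homogeneous_filter {T : Type} (F : set_system T) : Prop :=
  forall X, positive F X -> filter_iso X (filter_restr F X) setT F.

Definition filter_times_omega (F : set_system nat) : set_system (nat * nat) :=
  filter_from F (fun A => A `*` setT).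

Definition finite_to_one_property (F : set_system nat) : Prop :=
  forall f : nat -> nat,
    (forall A, F A -> forall m, exists2 n, A n & (m < f n)%N) ->
    exists2 A, positive F A &
      forall m, finite_set (A `&` f @^-1` [set m]).

Definition homeomorphic (X Y : topologicalType) : Prop :=
  exists (f : X -> Y) (g : Y -> X),
    [/\ continuous f, continuous g, cancel f g & cancel g f].

(* The space (X_n)_n \cup_F {oo}; the point oo is None, and the disjointness
   of the X_n is provided by the tags of the sigma type. *)
Definition filter_sum (F : set_system nat) (FF : ProperFilter F)
  (X : nat -> topologicalType) : Type := option {n & X n}.

Section filter_sum_topology.
Context (F : set_system nat) (FF : ProperFilter F).
Context (X : nat -> topologicalType).
Local Notation S := (filter_sum FF X).

HB.instance Definition _ := Choice.copy S (option {n & X n}).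

Definition filter_sum_basic (A : set nat) : set S :=
  [set p | if p is Some u then A (projT1 u) else True].

Definition filter_sum_nbhs (p : S) : set_system S :=
  if p is Some u then Some @ nbhs u else filter_from F filter_sum_basic.

HB.instance Definition _ := hasNbhs.Build S filter_sum_nbhs.

Let nbhs_pfilter (p : S) : ProperFilter (filter_sum_nbhs p).
Proof.
case: p => [u|] /=; first exact: fmap_proper_filter.
apply: filter_from_proper; last by move=> A _; exists None.
apply: filter_from_filter; first by exists setT; exact: filterT.
move=> A B FA FB; exists (A `&` B); first exact: filterI.
by case=> [u [Au Bu]|_]; split.
Qed.

Let nbhs_single (p : S) (U : set S) : filter_sum_nbhs p U -> U p.
Proof.
case: p => [u|] /=; first exact: nbhs_singleton.
by case=> A _; apply.
Qed.

Let nbhs_nbhs_sum (p : S) (U : set S) :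
  filter_sum_nbhs p U -> filter_sum_nbhs p (filter_sum_nbhs^~ U).
Proof.
case: p => [u|] /=.
  rewrite /nbhs/= => /nbhs_interior; exact: filterS.
case=> A FA AU; exists A => // -[[n x] /= An|_]; last by exists A.
by apply: filterS (@filterT _ (nbhs x) _) => y _; apply: AU.
Qed.

HB.instance Definition _ :=
  Nbhs_isNbhsTopological.Build S nbhs_pfilter nbhs_single nbhs_nbhs_sum.

End filter_sum_topology.

(* Ordinals are the elements of an arbitrary well-ordered type O, an element a
   standing for the order type of {b | b < a}; every ordinal arises this way,
   and a < omega_1 means that {b | b < a} is countable. *)
Section ordinals.
Context {d : Order.disp_t} {O : orderType d}.
Local Open Scope order_scope.

Variant ord_kind (a : O) : Type :=
| OrdZero of (forall b : O, ~~ (b < a))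
| OrdSucc (b : O) of (b < a) & (forall c : O, c < a -> c <= b)
| OrdLimit of (exists b : O, b < a)
    & (forall b : O, b < a -> exists2 c : O, b < c & c < a).

Definition ord_kindP (a : O) : ord_kind a.
Proof.
case: (pselect (exists b, b < a)) => [ex|nex]; last first.
  by apply: OrdZero => b; apply/negP => ba; apply: nex; exists b.
case: (pselect (exists b, b < a /\ forall c, c < a -> c <= b)) => [sa|nsa].
  by have [b [ba bmax]] := cid sa; exact: OrdSucc ba bmax.
apply: OrdLimit => // b ba; apply: contrapT => nb; apply: nsa.
exists b; split=> // c ca; rewrite leNgt; apply/negP => bc.
by apply: nb; exists c.
Defined.

Context (wf : well_founded (fun x y : O => x < y)).

(* The inner match isolates T_1; elsewhere the copies {n} x T_b of the successor
   clause are the summands of index n in filter_sum. *)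
Definition toronto_space (F : set_system nat) (FF : ProperFilter F) :
    O -> topologicalType :=
  Fix wf (fun=> topologicalType)
    (fun a (T : forall b, b < a -> topologicalType) =>
       match ord_kindP a with
       | OrdZero _ => discrete_topology void : topologicalType
       | OrdSucc b ba _ =>
           match ord_kindP b with
           | OrdZero _ => discrete_topology unit : topologicalType
           | _ => filter_sum FF (fun=> T b ba) : topologicalType
           end
       | OrdLimit _ _ =>
           {b : {b : O | b < a} & T (sval b) (svalP b)} : topologicalType
       end).

Definition cb_derivative (X : topologicalType) : O -> set X :=
  Fix wf (fun=> set X)
    (fun a (D : forall b, b < a -> set X) =>
       match ord_kindP a with
       | OrdZero _ => setT
       | OrdSucc b ba _ => D b ba `\` isolated (D b ba)
       | OrdLimit _ _ => [set x | forall b (ba : b < a), D b ba x]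
       end).
Arguments cb_derivative : clear implicits.

Definition scattered (X : topologicalType) : Prop :=
  exists a : O, cb_derivative X a = set0.

Definition has_rank (X : topologicalType) (a : O) : Prop :=
  cb_derivative X a = set0 /\
  forall b : O, b < a -> cb_derivative X b <> set0.

(* A coerces to the type set_type A, which carries the subspace topology. *)
Definition toronto (a : O) (X : topologicalType) : Prop :=
  [/\ scattered X, has_rank X a &
      forall A : set X, has_rank (A : topologicalType) a ->
        homeomorphic X A].

End ordinals.

(* Main.v *)
Require Import Defs.
From mathcomp Require Import all_boot all_order.
From mathcomp Require Import all_classical.
From mathcomp Require Import topology.
Set Implicit Arguments.
Unset Strict Implicit.
Unset Printing Implicit Defensive.
Import Order.TTheory.
Local Open Scope classical_set_scope.

(** The argument classifies the subspaces of T_a for countable a.  Call a space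
decomposable if it is a disjoint sum of countably many clopen pieces, each
homeomorphic to some T_s with s not a limit.  Three facts carry the proof.

A decomposable space of countable rank b > 0 is a sum of copies of T_b, and it
is T_b itself when b is a limit ([classification]).  The point is absorption
([absorbs_succ]): when a = b + 1, adding to T_a a decomposable space of rank at
most b changes nothing.  Indeed T_a consists of copies of T_b converging along
the filter F to one point; as F contains the cofinite sets, the added space can
be put into the copy of index 0, and by induction this copy becomes a sum of
copies of T_b.  A sequence of sums of copies of T_b converging along F is a
family of copies of T_b converging along F x omega, hence along F, and
homogeneity removes the empty members, so the result is T_a again
([cone_T], [cone_sum_T]).  At a limit rank, absorption piece by piece gives
that A and the sum of A and B are homeomorphic, so that any two decomposable
spaces of the same limit rank are homeomorphic ([decomposable_limit]).

Every subspace of T_a is decomposable ([decomposable_subspace]).  By induction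
only the neighbourhoods of the top point matter.  If this point has rank g in
the subspace, it suffices to regroup nearby pieces, all of rank at most g, into
a sequence of pieces of rank exactly g, still converging along F
([cone_decomposable_T]).  Let f measure how close the rank of the n-th piece is
to g along a sequence cofinal in g.  Then f is unbounded on every member of F,
hence finite-to-one on some F-positive set Y.  As F is homogeneous and
isomorphic to F x omega, the indices can be grouped so that the groups still
converge along F and each group meets Y in an infinite set
([filter_regroup]); f is unbounded on such a group, whose rank is therefore g.

Finally T_a has rank a ([rk_T]), and a subspace of T_a of rank a = b + 1 is a
single copy of T_a, not several, since T_a has only one point of rank b. *)

(** * Relational homeomorphisms, sums and cones *)

(** One half of a homeomorphism between sets, given as a relation: the graph of
a continuous map with domain [A].  With relations, homeomorphisms between the
pieces of two spaces are glued by taking their union, no value has to be chosen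
outside of [A], and both directions of a homeomorphism satisfy the same lemmas.
*)
Definition cts_rel (X Y : topologicalType) (A : set X) (R : X -> Y -> Prop) :=
  [/\ forall x y, R x y -> A x,
      forall x, A x -> exists y, R x y,
      forall x y y', R x y -> R x y' -> y = y' &
      forall x y, R x y -> forall V, nbhs y V ->
        nbhs x [set x' | forall y', R x' y' -> V y']].

Definition hrel (X Y : topologicalType) (A : set X) (B : set Y)
    (R : X -> Y -> Prop) :=
  cts_rel A R /\ cts_rel B (fun y x => R x y).

Definition homeo (X Y : topologicalType) (A : set X) (B : set Y) :=
  exists R, hrel A B R.

Notation "A ~= B" := (homeo A B) (at level 70).

Lemma homeo_refl (X : topologicalType) (A : set X) : A ~= A.
Proof.
exists (fun x y => x = y /\ A x); split; split.
- by move=> x y [].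
- by move=> x Ax; exists x.
- by move=> x y y' [<- _] [].
- by move=> x y [<- _] V Vx; apply: filterS Vx => x' Vx' _ [<-].
- by move=> x y [<-].
- by move=> x Ax; exists x.
- by move=> x y y' [-> _] [->].
- by move=> x y [-> _] V Vx; apply: filterS Vx => x' Vx' _ [->].
Qed.

Lemma hrel_sym (X Y : topologicalType) (A : set X) (B : set Y) R :
  hrel A B R -> hrel B A (fun y x => R x y).
Proof. by case. Qed.

Lemma homeo_sym (X Y : topologicalType) (A : set X) (B : set Y) :
  A ~= B -> B ~= A.
Proof. by case=> R /hrel_sym hR; eexists; exact: hR. Qed.

Lemma cts_rel_comp (X Y Z : topologicalType) (A : set X) (B : set Y) R S :
  cts_rel A R -> cts_rel B S -> (forall (x : X) (y : Y), R x y -> B y) ->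
  cts_rel A (fun (x : X) (z : Z) => exists2 y, R x y & S y z).
Proof.
move=> [R1 R2 R3 R4] [S1 S2 S3 S4] RB; split.
- by move=> x z [y /R1].
- move=> x /R2[y Rxy]; have [z Syz] := S2 _ (RB _ _ Rxy).
  by exists z; exists y.
- move=> x z z' [y Rxy Syz] [y' Rxy' Syz'].
  by move: Syz'; rewrite -(R3 _ _ _ Rxy Rxy') => /(S3 _ _ _ Syz).
- move=> x z [y Rxy Syz] V /(S4 _ _ Syz)/(R4 _ _ Rxy).
  by apply: filterS => x' RV z' [y' /RV]; exact.
Qed.

Lemma homeo_trans (X Y Z : topologicalType) (A : set X) (B : set Y)
  (C : set Z) : A ~= B -> B ~= C -> A ~= C.
Proof.
move=> [R [R1 R2]] [S [S1 S2]]; exists (fun x z => exists2 y, R x y & S y z).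
split.
  by apply: cts_rel_comp R1 S1 _ => x y; case: R2 => h _ _ _; exact: h.
have := cts_rel_comp S2 R2; have [SB _ _ _] := S1.
move=> /(_ (fun z y (h : S y z) => SB y z h)).
by congr cts_rel; apply/funext => z; apply/funext => x; apply/propext;
  split=> -[y]; exists y.
Qed.

Lemma homeo0 (X Y : topologicalType) (A : set X) (B : set Y) :
  A = set0 -> B = set0 -> A ~= B.
Proof. by move=> -> ->; exists (fun _ _ => False); split; split. Qed.

Lemma homeo1 (X Y : topologicalType) (x : X) (y : Y) : [set x] ~= [set y].
Proof.
exists (fun x' y' => x' = x /\ y' = y); split; split=> //=.
- by move=> ? ? [].
- by move=> _ ->; exists y.
- by move=> _ _ _ [_ ->] [_ ->].
- by move=> _ _ [-> ->] V Vy; apply: nearW => _ _ [_ ->]; exact: nbhs_singleton.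
- by move=> ? ? [].
- by move=> _ ->; exists x.
- by move=> _ _ _ [-> _] [-> _].
- by move=> _ _ [-> ->] V Vy; apply: nearW => _ _ [-> _]; exact: nbhs_singleton.
Qed.

Lemma hrel_sub (X Y : topologicalType) (A A' : set X) (B : set Y) R :
  hrel A B R -> A' `<=` A ->
  hrel A' [set y | exists2 x, A' x & R x y] (fun x y => R x y /\ A' x).
Proof.
move=> [[R1 R2 R3 R4] [R1' R2' R3' R4']] sA; split; split.
- by move=> x y [].
- by move=> x A'x; have [y Rxy] := R2 _ (sA _ A'x); exists y.
- by move=> x y y' [Rxy _] [Rxy' _]; exact: R3 Rxy Rxy'.
- move=> x y [Rxy _] V /(R4 _ _ Rxy); apply: filterS => x' h y' [Rxy' _].
  exact: h.
- by move=> y x [Rxy A'x]; exists x.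
- by move=> y [x A'x Rxy]; exists x.
- by move=> y x x' [Rxy _] [Rxy' _]; exact: R3' Rxy Rxy'.
- move=> x y [Rxy _] V /(R4' _ _ Rxy); apply: filterS => x' h y' [Rxy' _].
  exact: h.
Qed.

Lemma homeo_sub (X Y : topologicalType) (A A' : set X) (B : set Y) :
  A ~= B -> A' `<=` A -> exists2 B', B' `<=` B & A' ~= B'.
Proof.
move=> [R hR] sA; eexists; last by eexists; exact: hrel_sub hR sA.
by move=> y [x _ Rxy]; case: hR => _ [+ _ _ _]; apply; exact: Rxy.
Qed.

Lemma hrel_fun (X Y : topologicalType) (I : Type) (A : set X) (B : set Y) R
  (i0 : I) (q : Y -> I) : hrel A B R ->
  exists q' : X -> I, forall x y, R x y -> q' x = q y.
Proof.
move=> [[_ _ R3 _] _].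
exists (fun x => if pselect (exists y, R x y) is left h then q (sval (cid h))
  else i0) => x y Rxy.
case: pselect => [h|]; last by case; exists y.
by case: cid => /= y' Rxy'; rewrite (R3 _ _ _ Rxy Rxy').
Qed.

(** Continuity on [A] for the discrete topology on the index type: [q] splits
[A] into the relatively clopen sets [piece A q i]. *)
Definition locconst (X : topologicalType) (I : Type) (A : set X) (q : X -> I) :=
  forall x, A x -> nbhs x [set y | A y -> q y = q x].

Definition piece (X I : Type) (A : set X) (q : X -> I) (i : I) : set X :=
  [set x | A x /\ q x = i].

Lemma piece_sub (X I : Type) (A : set X) (q : X -> I) (i : I) :
  piece A q i `<=` A.
Proof. by move=> x []. Qed.

Lemma piece_const (X I : Type) (A : set X) (i : I) : piece A (fun=> i) i = A.
Proof. by rewrite predeqE => x; split=> [[]|]. Qed.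

Lemma piece_const0 (X I : Type) (A : set X) (i j : I) : i <> j ->
  piece A (fun=> i) j = set0.
Proof. by move=> ij; rewrite predeqE => x; split=> [[]|]. Qed.

Lemma locconst_sub (X : topologicalType) (I : Type) (A B : set X) (q : X -> I) :
  B `<=` A -> locconst A q -> locconst B q.
Proof. by move=> sBA h x /sBA/h; apply: filterS => y + /sBA; exact. Qed.

Lemma locconst_comp (X : topologicalType) (I J : Type) (A : set X)
  (q : X -> I) (t : I -> J) : locconst A q -> locconst A (t \o q).
Proof. by move=> h x /h; apply: filterS => y /= + Ay => ->. Qed.

(** A partition of each piece of a partition gives a partition of the whole. *)
Lemma locconst_refine (X : topologicalType) (I J : Type) (A : set X)
  (q : X -> I) (p : I -> X -> J) : locconst A q ->
  (forall i, locconst (piece A q i) (p i)) ->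
  locconst A (fun x => p (q x) x).
Proof.
move=> hq hp x Ax; have := hp (q x) x (conj Ax erefl).
apply: filterS2 (hq x Ax).
by move=> y hy py Ay; have e := hy Ay; rewrite e; apply: py; split.
Qed.

Lemma cts_rel_glue (X Y : topologicalType) (I : Type) (A : set X) (q : X -> I)
  (R : I -> X -> Y -> Prop) :
  locconst A q -> (forall i, cts_rel (piece A q i) (R i)) ->
  cts_rel A (fun x y => exists i, R i x y).
Proof.
move=> hq hR; have RA i x y : R i x y -> A x /\ q x = i.
  by case: (hR i) => + _ _ _; exact.
split.
- by move=> x y [i /RA[]].
- move=> x Ax; case: (hR (q x)) => _ /(_ x (conj Ax erefl))[y Rxy] _ _.
  by exists y; exists (q x).
- move=> x y y' [i Ri] [j Rj]; have [_ qi] := RA _ _ _ Ri.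
  have [_ qj] := RA _ _ _ Rj; subst i j.
  by case: (hR (q x)) => _ _ h _; exact: h Ri Rj.
- move=> x y [i Ri] V Vy; have [Ax qi] := RA _ _ _ Ri.
  case: (hR i) => _ _ _ /(_ x y Ri V Vy); apply: filterS2 (hq _ Ax).
  move=> x' h1 h2 y' [j Rj]; have [Ax' qj] := RA _ _ _ Rj.
  by apply: h2; rewrite -qi -(h1 Ax') qj.
Qed.

Lemma homeo_glue (X Y : topologicalType) (I : Type) (A : set X) (B : set Y)
  (q : X -> I) (p : Y -> I) : locconst A q -> locconst B p ->
  (forall i, piece A q i ~= piece B p i) -> A ~= B.
Proof.
move=> hq hp /choice[R hR]; exists (fun x y => exists i, R i x y); split.
  by apply: (cts_rel_glue hq) => i; case: (hR i).
by apply: (cts_rel_glue (R := fun i y x => R i x y) hp) => i; case: (hR i).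
Qed.

(** The intrinsic form, for a subset [A] of a space, of the topology of
[filter_sum]: outside of the apex [x0] the map [q] is continuous, and the sets
of points whose index is in a member of [F] form a neighbourhood base at [x0].
Being stated with bounded quantifiers over [A], it passes to all subsets that
contain [x0]. *)
Definition cone (X : topologicalType) (I : Type) (F : set_system I)
    (A : set X) (x0 : X) (q : X -> I) :=
  [/\ A x0, locconst (A `\ x0) q, forall x, (A `\ x0) x -> nbhs x (~` [set x0]),
      forall G, F G -> nbhs x0 [set y | (A `\ x0) y -> G (q y)] &
      forall U, nbhs x0 U ->
        exists2 G, F G & forall y, (A `\ x0) y -> G (q y) -> U y].

Lemma cone_sub (X : topologicalType) (I : Type) (F : set_system I)
    (A B : set X) (x0 : X) (q : X -> I) : B `<=` A -> B x0 ->
  cone F A x0 q -> cone F B x0 q.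
Proof.
move=> sBA Bx0 [_ h1 h2 h3 h4].
have sBA' : B `\ x0 `<=` A `\ x0 by exact: setSD.
split=> //.
- exact: locconst_sub sBA' h1.
- by move=> x /sBA'/h2.
- by move=> G /h3; apply: filterS => y + /sBA'; exact.
- by move=> U /h4[G FG h]; exists G => // y /sBA'; exact: h.
Qed.

(** The index map of a cone matters only through the filter that it induces
around the apex, so pieces can be merged or split at will as long as the two
filters have the same germs there. *)
Lemma cone_regroup (X : topologicalType) (I J : Type) (F : set_system I)
    (H : set_system J) (A : set X) (x0 : X) (q : X -> I) (p : X -> J) :
  cone F A x0 q -> locconst (A `\ x0) p ->
  (forall G, H G -> exists2 G', F G' &
     forall y, (A `\ x0) y -> G' (q y) -> G (p y)) ->
  (forall G, F G -> exists2 G', H G' &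
     forall y, (A `\ x0) y -> G' (p y) -> G (q y)) ->
  cone H A x0 p.
Proof.
move=> [Ax0 h1 h2 h3 h4] hp HF FH; split=> //.
- move=> G /HF[G' /h3 n h]; apply: filterS n => y G'y Ay.
  by apply: h => //; exact: G'y.
- move=> U /h4[G /FH[G' HG' h] hU]; exists G' => // y Ay Gy.
  by apply: hU => //; exact: h.
Qed.

Lemma cts_rel_cone (X Y : topologicalType) (I : Type) (F : set_system I)
    (A : set X) (x0 : X) (q : X -> I) (B : set Y) (y0 : Y) (p : Y -> I)
    (R : I -> X -> Y -> Prop) :
  cone F A x0 q -> cone F B y0 p ->
  (forall i, hrel (piece (A `\ x0) q i) (piece (B `\ y0) p i) (R i)) ->
  cts_rel A (fun x y => (x = x0 /\ y = y0) \/ exists i, R i x y).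
Proof.
move=> [Ax0 hq A0 AF _] [_ _ _ _ BF] hR.
have [G1 G2 G3 G4] := cts_rel_glue hq (fun i => proj1 (hR i)).
have RB i x y : R i x y -> (B `\ y0) y /\ p y = i.
  by case: (hR i) => _ [+ _ _ _]; apply.
have RA i x y : R i x y -> (A `\ x0) x /\ q x = i.
  by case: (hR i) => [[+ _ _ _] _]; apply.
split.
- by move=> x y [[->//]|/G1[]].
- move=> x Ax; have [->|xx0] := eqVneq x x0; first by exists y0; left.
  have [|y Ry] := G2 x; first by split=> // /eqP; rewrite (negPf xx0).
  by exists y; right.
- move=> x y y' [[-> ->]|h] [[xx0 ->]|h'] //.
  + by case: (G1 _ _ h') => _ [].
  + by subst x; case: (G1 _ _ h) => _ [].
  + exact: G3 h h'.
- move=> x y [[-> ->]|h] V Vy.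
    have [G /AF n hG] := BF _ Vy; apply: filterS n => x' h y'.
    move=> [[_ ->]|[i Ri]]; first exact: nbhs_singleton.
    have [By' pi] := RB _ _ _ Ri; have [Ax' qi] := RA _ _ _ Ri.
    by apply: hG => //; rewrite pi -qi; exact: h.
  apply: filterS2 (G4 _ _ h _ Vy) (A0 _ (G1 _ _ h)) => x' h1 h2 y' [[/h2 []]|].
  exact: h1.
Qed.

Lemma homeo_cone (X Y : topologicalType) (I : Type) (F : set_system I)
    (A : set X) (x0 : X) (q : X -> I) (B : set Y) (y0 : Y) (p : Y -> I) :
  cone F A x0 q -> cone F B y0 p ->
  (forall i, piece (A `\ x0) q i ~= piece (B `\ y0) p i) -> A ~= B.
Proof.
move=> cA cB /choice[R hR].
exists (fun x y => (x = x0 /\ y = y0) \/ exists i, R i x y).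
split; first exact: cts_rel_cone cA cB hR.
have := cts_rel_cone cB cA (fun i => hrel_sym (hR i)).
by congr cts_rel; apply/funext => y; apply/funext => x; apply/propext;
  split=> -[[]|[i h]]; [left|right; exists i|left|right; exists i].
Qed.

Lemma locconst_transport (X Y : topologicalType) (I : Type)
    (A : set X) (B : set Y) (q : X -> I) (p : Y -> I) R :
  hrel A B R -> (forall x y, R x y -> q x = p y) -> locconst B p ->
  locconst A q.
Proof.
move=> [[_ R2 _ R4] [S1 _ _ _]] Rqp hp x Ax; have [y Rxy] := R2 _ Ax.
have By := S1 _ _ Rxy; apply: filterS (R4 _ _ Rxy _ (hp _ By)) => x' h Ax'.
have [y' Rxy'] := R2 _ Ax'.
rewrite (Rqp _ _ Rxy') (Rqp _ _ Rxy); apply: h => //; exact: S1 Rxy'.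
Qed.

Lemma piece_transport (X Y : topologicalType) (I : Type)
    (A : set X) (B : set Y) (q : X -> I) (p : Y -> I) R i :
  hrel A B R -> (forall x y, R x y -> q x = p y) ->
  piece A q i ~= piece B p i.
Proof.
move=> hR Rqp; have := hrel_sub hR (@piece_sub _ _ A q i).
set B' := [set _ | _]; suff -> : B' = piece B p i.
  by move=> hR'; eexists; exact: hR'.
have [[R1 _ _ _] [S1 S2 _ _]] := hR.
rewrite predeqE => y; split=> [[x [Ax qx] Rxy]|[By py]].
  by split; [exact: S1 Rxy|rewrite -(Rqp _ _ Rxy)].
have [x Rxy] := S2 _ By; exists x => //.
by split; [exact: R1 Rxy|rewrite (Rqp _ _ Rxy)].
Qed.

Lemma hrel_del (X Y : topologicalType) (A : set X) (B : set Y) R x0 y0 :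
  hrel A B R -> R x0 y0 ->
  hrel (A `\ x0) (B `\ y0) (fun x y => R x y /\ (A `\ x0) x).
Proof.
move=> hR Rxy0; have := hrel_sub hR (@subDsetl _ A [set x0]).
congr hrel; rewrite predeqE => y.
have [[R1 R2 R3 R4] [S1 S2 S3 S4]] := hR.
split=> [[x [Ax xx0] Rxy]|[By yy0]].
  split; first exact: S1 Rxy.
  by move=> yy0; apply: xx0; rewrite -yy0 in Rxy0; exact: S3 Rxy Rxy0.
have [x Rxy] := S2 _ By; exists x => //; split; first exact: R1 Rxy.
by move=> xx0; apply: yy0; rewrite xx0 in Rxy; exact: R3 Rxy Rxy0.
Qed.

Lemma cone_transport (X Y : topologicalType) (I : Type) (i0 : I)
    (F : set_system I) (A : set X) (B : set Y) (y0 : Y) (p : Y -> I) :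
  A ~= B -> cone F B y0 p -> exists x0 q, cone F A x0 q /\
    forall i, piece (A `\ x0) q i ~= piece (B `\ y0) p i.
Proof.
move=> [R hR] [By0 lp B0 BF FB].
have [[R1 R2 R3 R4] [S1 S2 S3 S4]] := hR.
have [x0 Rxy0] := S2 _ By0.
have [q Rqp] := hrel_fun i0 p hR.
have hR' := hrel_del hR Rxy0.
have Rqp' x y : R x y /\ (A `\ x0) x -> q x = p y by case=> /Rqp.
have RB x y : R x y -> (A `\ x0) x -> (B `\ y0) y.
  by case: hR' => _ [h _ _ _] Rxy Ax; exact: (h _ x).
exists x0, q; split; last by move=> i; exact: piece_transport hR' Rqp'.
split.
- exact: R1 Rxy0.
- exact: locconst_transport hR' Rqp' lp.
- move=> x Ax; have [y Rxy] := R2 _ Ax.1.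
  apply: filterS (R4 _ _ Rxy _ (B0 _ (RB _ _ Rxy Ax))) => x' h xx0.
  by apply: (h y0) => //; rewrite xx0.
- move=> G /BF/(R4 _ _ Rxy0); apply: filterS => x h Ax.
  have [y Rxy] := R2 _ Ax.1; rewrite (Rqp _ _ Rxy).
  by apply: h => //; exact: RB Ax.
- move=> U /(S4 _ _ Rxy0)/FB[G FG hG]; exists G => // x Ax.
  have [y Rxy] := R2 _ Ax.1; rewrite (Rqp _ _ Rxy) => Gy.
  by apply: (hG y) => //; exact: RB Ax.
Qed.

(** * Cantor-Bendixson derivatives of subsets *)

Section derivative.
Context {d : Order.disp_t} {O : orderType d}.
Local Open Scope order_scope.
Context (wf : well_founded (fun x y : O => x < y)).

Definition is_zero (a : O) := forall b : O, ~~ (b < a).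
Definition is_succ (a b : O) := b < a /\ forall c : O, c < a -> c <= b.
Definition is_limit (a : O) := (exists b : O, b < a) /\
  forall b : O, b < a -> exists2 c : O, b < c & c < a.

Lemma zero_le a b : is_zero a -> a <= b.
Proof. by move=> /(_ b); rewrite -leNgt. Qed.

Lemma zero_lt a b : ~ is_zero a -> is_zero b -> b < a.
Proof.
move=> na zb; rewrite lt_neqAle zero_le// andbT.
by apply/eqP => ba; apply: na; rewrite -ba.
Qed.

Lemma lt_nzero (a b : O) : b < a -> ~ is_zero a.
Proof. by move=> ba /(_ b); rewrite ba. Qed.

Lemma succ_lt a b : is_succ a b -> b < a. Proof. by case. Qed.

Lemma succ_le a b c : is_succ a b -> b < c -> a <= c.
Proof.
move=> [ba h] bc; rewrite leNgt; apply/negP => /h.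
by rewrite leNgt bc.
Qed.

Lemma ord_cases a : [\/ is_zero a, exists b, is_succ a b | is_limit a].
Proof.
case: (ord_kindP a) => [za|b ba hb|ex la]; first exact: Or31.
  by apply: Or32; exists b.
exact: Or33.
Qed.

Lemma limit_succ a b : is_limit a -> is_succ a b -> False.
Proof.
move=> [_ h] [ba hb]; have [c bc /hb] := h _ ba.
by rewrite leNgt bc.
Qed.

Lemma limit_nzero a : is_limit a -> ~ is_zero a.
Proof. by move=> [[b ba] _]; exact: lt_nzero ba. Qed.

Lemma wf_min (P : O -> Prop) : (exists a, P a) ->
  exists2 a, P a & forall b, P b -> a <= b.
Proof.
move=> [a Pa]; apply: contrapT => h; move: Pa.
elim/(well_founded_ind wf): a => a IH Pa; apply: h; exists a => // b Pb.
by rewrite leNgt; apply/negP => ba; exact: IH Pb.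
Qed.

Lemma ex_zero (a : O) : exists z : O, is_zero z.
Proof.
have [|z _ h] := wf_min (P := fun=> True); first by exists a.
by exists z => b; rewrite -leNgt h.
Qed.

Lemma ex_succ (a b : O) : b < a -> exists2 c, is_succ c b & c <= a.
Proof.
move=> ba; have [|c bc h] := wf_min (P := fun c => b < c); first by exists a.
exists c; last exact: h.
by split=> // x; rewrite [x <= b]leNgt; apply: contraTN => /h; rewrite -leNgt.
Qed.

(** Derivative of a subset of [X] for its subspace topology, as a set of points
of [X].  The clause below treats zero, successor and limit ordinals uniformly:
a point survives to stage [a] if it is an accumulation point of all earlier
stages. *)
Definition cb (X : topologicalType) (A : set X) : O -> set X :=
  Fix wf (fun=> set X) (fun a (D : forall b, b < a -> set X) =>
    [set x | A x /\ forall b (ba : b < a), limit_point (D b ba) x]).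

Lemma cbE (X : topologicalType) (A : set X) a x :
  cb A a x <-> A x /\ forall b, b < a -> limit_point (cb A b) x.
Proof.
rewrite /cb Fix_eq// => b f g fg; rewrite predeqE => y.
by split=> -[Ay h]; split=> // c cb; rewrite (fg, =^~ fg).
Qed.

Lemma cb_sub (X : topologicalType) (A : set X) a : cb A a `<=` A.
Proof. by move=> x /cbE[]. Qed.

Lemma cb_anti (X : topologicalType) (A : set X) a b : a <= b ->
  cb A b `<=` cb A a.
Proof.
move=> ab x /cbE[Ax h]; apply/cbE; split=> // c ca; apply: h.
exact: lt_le_trans ca ab.
Qed.

Lemma cb_zero (X : topologicalType) (A : set X) a : is_zero a -> cb A a = A.
Proof.
move=> za; rewrite predeqE => x; split; first exact: cb_sub.
by move=> Ax; apply/cbE; split=> // b; rewrite (negPf (za b)).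
Qed.

Lemma limit_pointS (X : topologicalType) (A B : set X) : A `<=` B ->
  limit_point A `<=` limit_point B.
Proof.
by move=> AB x h U /h[y [? ? ?]]; exists y; split=> //; exact: AB.
Qed.

Lemma cb_succ (X : topologicalType) (A : set X) a b x : is_succ a b ->
  A x -> limit_point (cb A b) x -> cb A a x.
Proof.
move=> [_ h] Ax lx; apply/cbE; split=> // c /h cb.
exact: limit_pointS (cb_anti cb) _ lx.
Qed.

(** Being in a derivative depends only on the germ of the set at the point. *)
Lemma cb_locS (X : topologicalType) (A B : set X) a x :
  nbhs x [set y | A y -> B y] -> cb A a x -> cb B a x.
Proof.
elim/(well_founded_ind wf): a x => a IH x xAB /cbE[Ax h]; apply/cbE.
split; first exact: (nbhs_singleton xAB).
move=> b ba U xU.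
have [y [yx Ay [yAB Uy]]] := h b ba _ (filterI (nbhs_interior xAB) xU).
exists y; split=> //.
exact: IH.
Qed.

Lemma cb_local (X : topologicalType) (A B : set X) a x :
  nbhs x [set y | A y <-> B y] -> cb A a x <-> cb B a x.
Proof.
by move=> h; split; apply: cb_locS; apply: filterS h => y [].
Qed.

Lemma cbS (X : topologicalType) (A B : set X) a : A `<=` B ->
  cb A a `<=` cb B a.
Proof. by move=> AB x; apply: cb_locS; apply: nearW; exact: AB. Qed.

Lemma hrel_cb1 (X Y : topologicalType) (A : set X) (B : set Y) R a x y :
  hrel A B R -> R x y -> cb A a x -> cb B a y.
Proof.
move=> [[R1 R2 R3 R4] [S1 S2 S3 S4]].
elim/(well_founded_ind wf): a x y => a IH x y Rxy /cbE[Ax h]; apply/cbE.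
split; first exact: S1 Rxy.
move=> b ba U yU; have [x' [xx' bx' Ux']] := h b ba _ (R4 _ _ Rxy _ yU).
have [y' Rxy'] := R2 _ (cb_sub bx'); exists y'; split.
- apply: contraNneq xx' => yy'; apply/eqP; apply: (S3 y _ _ _ Rxy).
  by rewrite -yy'.
- exact: IH Rxy' bx'.
- exact: Ux'.
Qed.

Lemma hrel_cb (X Y : topologicalType) (A : set X) (B : set Y) R a x y :
  hrel A B R -> R x y -> (cb A a x <-> cb B a y).
Proof.
move=> hR Rxy; split; first exact: hrel_cb1 hR Rxy.
exact: hrel_cb1 (hrel_sym hR) Rxy.
Qed.

Lemma homeo_cb0 (X Y : topologicalType) (A : set X) (B : set Y) a :
  A ~= B -> cb A a !=set0 -> cb B a !=set0.
Proof.
move=> [R hR] [x ax]; have [[_ R2 _ _] _] := hR.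
have [y Rxy] := R2 _ (cb_sub ax); exists y.
by rewrite -(hrel_cb a hR Rxy).
Qed.

Lemma cb_piece (X : topologicalType) (I : Type) (A : set X) (q : X -> I) a x :
  locconst A q -> A x -> (cb A a x <-> cb (piece A q (q x)) a x).
Proof.
move=> hq Ax; apply: cb_local; apply: filterS (hq _ Ax) => y h.
by split=> [Ay|[]//]; split=> //; exact: h.
Qed.

Lemma cb_sum0 (X : topologicalType) (I : Type) (A : set X) (q : X -> I) a :
  locconst A q -> (cb A a !=set0 <-> exists i, cb (piece A q i) a !=set0).
Proof.
move=> hq; split=> [[x ax]|[i [x ax]]].
  by exists (q x), x; apply/(cb_piece a hq (cb_sub ax)).
by exists x; apply: cbS ax; exact: piece_sub.
Qed.

Lemma cone_del (X : topologicalType) (I : Type) (F : set_system I) (A : set X)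
  x0 (q : X -> I) a x :
  cone F A x0 q -> x <> x0 -> cb A a x <-> cb (A `\ x0) a x.
Proof.
move=> [_ _ h _ _] xx0; split=> [ax|]; last by apply: cbS; exact: subDsetl.
apply: (cb_locS _ ax); apply: filterS (h x _) => //.
by split=> //; apply: cb_sub; exact: ax.
Qed.

Definition rk (X : topologicalType) (A : set X) (a : O) :=
  cb A a = set0 /\ forall b, b < a -> cb A b !=set0.

Lemma homeo_rk (X Y : topologicalType) (A : set X) (B : set Y) a :
  A ~= B -> rk A a -> rk B a.
Proof.
move=> AB [h1 h2]; split=> [|b /h2]; last exact: homeo_cb0.
by apply/eqP/negPn/negP => /set0P/(homeo_cb0 (homeo_sym AB)); rewrite h1 => -[].
Qed.

Lemma rk_le (X : topologicalType) (A : set X) a b :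
  rk A a -> cb A b = set0 -> a <= b.
Proof.
move=> [_ h] b0; rewrite leNgt; apply/negP => /h; rewrite b0.
by case.
Qed.

Lemma rk_zero (X : topologicalType) (A : set X) a : is_zero a -> rk A a ->
  A = set0.
Proof. by move=> za [<- _]; rewrite cb_zero. Qed.

Lemma rk_nonempty (X : topologicalType) (A : set X) a : ~ is_zero a -> rk A a ->
  A !=set0.
Proof.
move=> na [_ h]; have [z zz] := ex_zero a.
by have [x /cb_sub Ax] := h z (zero_lt na zz); exists x.
Qed.

(* relation with cb_derivative *)
Lemma not_limit_isolated (X : topologicalType) (A : set X) x : A x ->
  (~ isolated A x <-> limit_point A x).
Proof.
move=> Ax; split=> [nix|lx ix]; last first.
  by have /disj_setPS/(_ x) := disjoint_isolated_limit_point A; apply.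
have : closure A x by exact: subset_closure.
by rewrite closure_isolated_limit_point => -[].
Qed.

Lemma cb_derivativeE (X : topologicalType) a :
  @cb_derivative _ _ wf X a = cb setT a.
Proof.
elim/(well_founded_ind wf): a => a IH.
rewrite /Defs.cb_derivative Fix_eq; last first.
  move=> b f g fg; case: ord_kindP => //.
    by move=> c cb _; rewrite fg.
  move=> _ _; rewrite predeqE => y.
  by split=> h c cb; rewrite (fg, =^~ fg).
rewrite -/(@cb_derivative _ _ wf X).
case: ord_kindP => [za|b ba hb|nz la].
- by rewrite cb_zero.
- rewrite IH// predeqE => x; split=> [[bx nx]|ax].
    by apply: (@cb_succ _ _ _ b); [| |exact/not_limit_isolated].
  have bx : cb setT b x by apply: cb_anti ax; exact: ltW.
  split=> //; apply/not_limit_isolated => //.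
  by move/cbE: ax => [_]; exact.
- rewrite predeqE => x; split=> [h|ax b ba].
    apply/cbE; split=> // b /la[c bc ca].
    have := h _ ca; rewrite -/(@cb_derivative _ _ wf X c) IH// => /cbE[_].
    exact.
  by rewrite -/(@cb_derivative _ _ wf X b) IH//; apply: cb_anti ax; exact: ltW.
Qed.

Lemma has_rankE (X : topologicalType) a : has_rank wf X a <-> rk [set: X] a.
Proof.
split=> -[h1 h2]; split.
- by rewrite -cb_derivativeE.
- by move=> b /h2/eqP/set0P; rewrite -cb_derivativeE.
- by rewrite cb_derivativeE.
- by move=> b /h2/set0P/eqP; rewrite -cb_derivativeE.
Qed.

End derivative.

(** Subspaces are studied below as subsets of a fixed space; this lemma gives the
passage to the types of their points. *)
Lemma homeo_set_type (X : topologicalType) (A : set X) :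
  [set: (A : topologicalType)] ~= A.
Proof.
exists (fun (u : A) x => set_val u = x); split; split=> //=.
- by move=> u _; exists (set_val u).
- by move=> u x y <-.
- move=> u x <- V Vx.
  have h : nbhs (u : (A : topologicalType)) (set_val @^-1` V).
    exact: (@initial_continuous A X set_val u V Vx).
  by apply: (filterS _ h) => v Vv _ <-.
- by move=> x u <-; exact: set_valP.
- by move=> x Ax; exists (SigSub (mem_set Ax)).
- by move=> x u v <- /val_inj.
- move=> x u <- V; rewrite nbhsE => -[W [[W' oW' <-] W'u] WV].
  exists W'; first by split.
  move=> x' Wx' v e.
  by apply: WV; rewrite /= e.
Qed.

Lemma homeo_homeomorphic (X Y : topologicalType) :
  [set: X] ~= [set: Y] -> homeomorphic X Y.
Proof.
move=> [R [[_ R2 R3 R4] [_ S2 S3 S4]]].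
have [f Rf] := choice (fun x => R2 x I).
have [g Rg] := choice (fun y => S2 y I).
exists f, g; split.
- by move=> x V /(R4 _ _ (Rf x)); apply: filterS => x'; exact.
- by move=> y V /(S4 _ _ (Rg y)); apply: filterS => y'; exact.
- by move=> x; apply: S3 (Rg _) (Rf _).
- by move=> y; apply: R3 (Rf _) (Rg _).
Qed.

(** * Homogeneous filters isomorphic to F x omega *)

Section filters.
Context (F : set_system nat) (FF : ProperFilter F).
Context (F_homogeneous : homogeneous_filter F).
Context (F_times : filter_iso setT F setT (filter_times_omega F)).

(** A point in all members of [F] would be a positive singleton, on which the
restriction of [F] lives on one point only, unlike [F]. *)
Lemma filter_free n : F [set k | k <> n].
Proof.
apply: contrapT => nF; have pos : positive F [set n].
  move=> A FA; apply: contrapT => h; apply: nF; apply: filterS FA => k Ak kn.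
  by apply: h; exists n; split=> //; rewrite -kn.
have [t [[_ _ tsurj] _]] := F_homogeneous pos.
have [k /= -> t0] := tsurj 0 I; have [l /= -> t1] := tsurj 1 I.
by rewrite t0 in t1.
Qed.

(* a map carrying filter on Z *)
(** The preimages under [t] of members of [F] are members of the restriction of
[F] to [Z], and they are cofinal in it: exactly what is needed to use [t] for
reindexing a cone over [F]. *)
Definition carries_filter (Z : set nat) (t : nat -> nat) :=
  (forall H, F H -> F [set n | Z n -> H (t n)]) /\
  (forall G, F G -> F [set m | forall n, Z n -> t n = m -> G n]).

Lemma positive_iso Z : positive F Z -> exists t : nat -> nat,
  [/\ forall m n, Z m -> Z n -> t m = t n -> m = n,
      forall m, exists2 n, Z n & t n = m & carries_filter Z t].
Proof.
move=> /F_homogeneous[t [[tmap tinj tsurj] tF]]; exists t.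
have inj m n : Z m -> Z n -> t m = t n -> m = n.
  by move=> Zm Zn; apply: tinj; exact: mem_set.
have surj m : exists2 n, Z n & t n = m.
  by have [n Zn tn] := tsurj m I; exists n.
split=> //; split=> [H FH|G FG].
  have [_ /(_ _)[|A FA AZ]] := tF _ (@subIsetl _ Z (t @^-1` H)).
    apply: filterS FH => m Hm; have [n Zn tn] := surj m.
    by exists n => //; split=> //=; rewrite tn.
  apply: filterS FA => n An Zn.
  by have : (A `&` Z) n by []; rewrite AZ => -[].
have [h _] := tF _ (@subIsetr _ G Z).
apply: filterS (h (ex_intro2 _ _ G FG erefl)) => m [s [Gs Zs] <-] n Zn.
by move=> /(inj _ _ Zn Zs) ->.
Qed.

Lemma times_iso : exists t : nat -> nat * nat,
  [/\ injective t, forall p, exists n, t n = p &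
      carries_filter setT (fst \o t)].
Proof.
have [t [[tmap tinj tsurj] tF]] := F_times; exists t.
have inj : injective t by move=> m n; apply: tinj; exact: mem_set.
have surj p : exists n, t n = p by have [n _ tn] := tsurj p I; exists n.
split=> //; split=> [H FH|G FG].
  have [_ h] := tF [set n | H (t n).1] (fun _ _ => I).
  suff : F [set n | H (t n).1] by apply: filterS => n Hn _.
  apply: h; exists H => // p [Hp _]; have [n tn] := surj p; exists n => //=.
  by rewrite tn.
have [/(_ FG)[A FA AG] _] := tF G (fun _ _ => I).
apply: filterS FA => m Am n _ /= tn.
by have [|g Gg /inj <-] := AG (t n); first by rewrite -tn in Am; split.
Qed.

(** Either the complement of [Y] is positive and homogeneity applies, or [Y] is
in [F] and a constant map will do, since [F] is free. *)
Lemma carries_filter_compl Y : exists s : nat -> nat, carries_filter (~` Y) s.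
Proof.
have [/positive_iso[t [_ _ ht]]|nY] := pselect (positive F (~` Y)).
  by exists t.
have FY : F Y.
  apply: contrapT => nFY; apply: nY => A FA; apply: contrapT => h; apply: nFY.
  by apply: filterS FA => n An; apply: contrapT => nYn; apply: h; exists n.
exists (fun=> 0); split=> [H FH|G FG].
  by apply: filterS FY => n Yn /(_ Yn).
by apply: filterS (filter_free 0) => m m0 n _ /esym/m0.
Qed.

(** On [Y], identify the restriction of [F] first with [F], then with F x omega,
and project to the first coordinate: the fibres are infinite.  Outside of [Y],
any map carrying the rest of [F] will do, since [F] is the sum of its
restrictions to [Y] and to the complement of [Y]. *)
Lemma filter_regroup Y : positive F Y -> exists r : nat -> nat,
  carries_filter setT r /\ forall m, ~ finite_set (Y `&` r @^-1` [set m]).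
Proof.
move=> /positive_iso[t [tinj tsurj [t1 t2]]].
have [v [vinj vsurj [v1 v2]]] := times_iso.
have [s [s1 s2]] := carries_filter_compl Y.
exists (fun n => if n \in Y then (v (t n)).1 else s n); split; first split.
- move=> H FH; apply: filterS2 (t1 _ (v1 _ FH)) (s1 _ FH) => n h1 h2 _ /=.
  by case: ifPn => [/set_mem Yn|/negP Yn]; [exact: h1|apply: h2 => /mem_set].
- move=> G FG; apply: filterS2 (v2 _ (t2 _ FG)) (s2 _ FG) => m h1 h2 n _.
  case: ifPn => [/set_mem Yn e|/negP Yn].
    exact: (h1 (t n)).
  by apply: h2 => /mem_set.
- move=> m /(finite_image (fun n => (v (t n)).2)) h; apply: infinite_nat.
  apply: sub_finite_set h => k _; have [l vl] := vsurj (m, k).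
  have [n Yn tn] := tsurj l; exists n; last by rewrite tn vl.
  by split=> //=; rewrite (mem_set Yn) tn vl.
Qed.

End filters.

(** * The recursive description of the spaces T_a *)

Lemma sigT_piece (I : choiceType) (X : I -> topologicalType) (i : I) :
  piece [set: {i & X i}] (@projT1 _ _) i ~= [set: X i].
Proof.
exists (fun p x => p = existT X i x); split; split=> //=.
- by move=> p x ->; split.
- by case=> j x [_ /= <-]; exists x.
- by move=> p x y -> e; exact: existT_inj2 e.
- move=> p x -> V Vx; apply: (@filterS _ (nbhs x) _ V _ _ Vx) => y Vy z e.
  by rewrite -(existT_inj2 e); exact: Vy.
- by move=> x _; exists (existT X i x).
- by move=> x p p' -> ->.
- by move=> x p -> V Vp; apply: (@filterS _ (nbhs x) _ _ _ _ Vp) => y Vy p' ->.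
Qed.

Lemma sigT_locconst (I : choiceType) (X : I -> topologicalType) :
  locconst [set: {i & X i}] (@projT1 _ _).
Proof. by case=> i x _; apply: (@filterE _ (nbhs x)). Qed.

Lemma filter_sum_cone (F : set_system nat) (FF : ProperFilter F)
    (X : nat -> topologicalType) :
  exists q, cone F [set: filter_sum FF X] None q /\
    forall n, piece ([set: filter_sum FF X] `\ None) q n ~= [set: X n].
Proof.
exists (fun p => if p is Some u then projT1 u else 0); split; first split=> //.
- move=> [[n x]|] [_ /= nN]; last by case: nN.
  exact: (@filterE _ (nbhs x)).
- move=> [[n x]|] [_ /= nN]; last by case: nN.
  exact: (@filterE _ (nbhs x)).
- by move=> G FG; exists G => // -[u Gu _ //|_ [_ /=]]; case.
- move=> U [G FG GU]; exists G => // -[u _ Gu|[_ /=]]; last by case.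
  exact: GU.
- move=> n; exists (fun p x => p = Some (existT X n x)); split; split=> //=.
  + by move=> p x ->.
  + by move=> [[m x]|] [[_ /= nN] e]; [subst m; exists x|case: nN].
  + by move=> p x y -> [e]; exact: existT_inj2 e.
  + move=> p x -> V Vx.
    apply: (@filterS _ (nbhs x) _ V _ _ Vx) => y Vy z [e].
    by rewrite -(existT_inj2 e); exact: Vy.
  + by move=> x _; exists (Some (existT X n x)).
  + by move=> x p p' -> ->.
  + move=> x p -> V Vp.
    by apply: (@filterS _ (nbhs x) _ _ _ _ Vp) => y Vy p' ->.
Qed.

Section toronto_unfold.
Context {d : Order.disp_t} {O : orderType d}.
Local Open Scope order_scope.
Context (wf : well_founded (fun x y : O => x < y)).
Context (F : set_system nat) (FF : ProperFilter F).
Local Notation T := (toronto_space wf FF).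

Lemma toronto_spaceE a : T a =
  match ord_kindP a with
  | OrdZero _ => discrete_topology void : topologicalType
  | OrdSucc b _ _ =>
     match ord_kindP b with
     | OrdZero _ => discrete_topology unit : topologicalType
     | _ => filter_sum FF (fun=> T b) : topologicalType
     end
  | OrdLimit _ _ => {b : {b : O | b < a} & T (sval b)} : topologicalType
  end.
Proof.
rewrite {1}/toronto_space Fix_eq//.
move=> b f g fg; case: ord_kindP => //.
  by move=> c cb _; rewrite fg.
move=> _ _; suff -> : f = g by [].
by apply: functional_extensionality_dep => x;
  apply: functional_extensionality_dep => y; exact: fg.
Qed.

Lemma T_zero a : is_zero a -> [set: T a] = set0.
Proof.
move=> za; rewrite toronto_spaceE; case: ord_kindP => [_|b ba|[b ba]].
- by rewrite predeqE; case.
- by have := za b; rewrite ba.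
- by have := za b; rewrite ba.
Qed.

Lemma succ_uniq (a b c : O) : is_succ a b -> is_succ a c -> b = c.
Proof.
by move=> [ba hb] [ca hc]; apply/le_anti; rewrite hc// hb.
Qed.

Lemma T_one a b : is_succ a b -> is_zero b -> exists x, [set: T a] = [set x].
Proof.
move=> ab zb; rewrite toronto_spaceE; case: ord_kindP => [za|c ca hc|h1 h2].
- by have := za b; rewrite (succ_lt ab).
- rewrite (@succ_uniq a c b)//; case: ord_kindP => [_|e eb|[e eb]].
  + by exists tt; rewrite predeqE; case.
  + by have := zb e; rewrite eb.
  + by have := zb e; rewrite eb.
- by case: (@limit_succ _ _ a b).
Qed.

Lemma T_succ a b : is_succ a b -> ~ is_zero b -> exists x0 q,
  cone F [set: T a] x0 q /\
  forall n, piece ([set: T a] `\ x0) q n ~= [set: T b].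
Proof.
move=> ab zb; rewrite (toronto_spaceE a).
case: ord_kindP => [za|c ca hc|h1 h2].
- by have := za b; rewrite (succ_lt ab).
- rewrite (@succ_uniq a c b)//; case: ord_kindP => // *;
    by eexists; exact: filter_sum_cone.
- by case: (@limit_succ _ _ a b).
Qed.

Lemma T_limit a : is_limit a -> exists q : T a -> O,
  [/\ locconst [set: T a] q, forall x, q x < a &
      forall b, b < a -> piece [set: T a] q b ~= [set: T b]].
Proof.
move=> la; rewrite (toronto_spaceE a).
case: ord_kindP => [za|b ba hb|_ _].
- by have := limit_nzero la za.
- by case: (@limit_succ _ _ a b).
- exists (fun p => sval (projT1 p)); split.
  + exact: (locconst_comp sval (@sigT_locconst _ _)).
  + by move=> [[b ba] x].
  + move=> b ba.
    have := sigT_piece (fun b : {b | b < a} => T (sval b)) (exist _ b ba).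
    congr homeo; rewrite predeqE => -[[c ca] x].
    split=> -[_ /=]; last by move=> cb; split=> //; apply: val_inj.
    by case.
Qed.

End toronto_unfold.

(** * Cones over sums of copies of T_b *)

Section cone_rank.
Context {d : Order.disp_t} {O : orderType d}.
Local Open Scope order_scope.
Context (wf : well_founded (fun x y : O => x < y)).
Local Notation cb := (cb wf).
Context (X : topologicalType) (I : Type) (F : set_system I) (A : set X).
Context (x0 : X) (q : X -> I) (cA : cone F A x0 q).

Lemma cone_cb_piece c x : A x -> x <> x0 ->
  (cb A c x <-> cb (piece (A `\ x0) q (q x)) c x).
Proof.
move=> Ax xx0; rewrite (cone_del wf c cA xx0); apply: cb_piece; last by split.
by case: cA.
Qed.

Lemma cone_limit c :
  limit_point (cb A c) x0 <->
  forall G, F G -> exists2 i, G i & cb (piece (A `\ x0) q i) c !=set0.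
Proof.
have [Ax0 _ _ AF FA] := cA; split=> [lx G /AF/lx[y [/eqP yx0 cy Gy]]|h U].
  have Ay := cb_sub cy; exists (q y); first by apply: Gy; split.
  by exists y; apply/(cone_cb_piece c Ay yx0).
move=> /FA[G /h[i Gi [y cy]] GU]; have [[Ay yx0] qy] := cb_sub cy.
exists y; split; first exact/eqP.
  by apply/(cone_cb_piece c Ay yx0); rewrite qy.
by apply: GU; rewrite // qy.
Qed.

End cone_rank.

Section toronto_cones.
Context {d : Order.disp_t} {O : orderType d}.
Local Open Scope order_scope.
Context (wf : well_founded (fun x y : O => x < y)).
Context (F : set_system nat) (FF : ProperFilter F).
Local Notation T := (toronto_space wf FF).
Local Notation cb := (cb wf).
Local Notation rk := (rk wf).

(** If the pieces have rank [b], the apex is their accumulation point at all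
stages below [b], and no other point survives to stage [b]. *)
Lemma cone_rank_top (X : topologicalType) (A : set X) x0 q b :
  cone F A x0 q -> (forall n, rk (piece (A `\ x0) q n) b) ->
  cb A b = [set x0].
Proof.
move=> cA rA; rewrite predeqE => x; split=> [bx|->].
  apply: contrapT => /= xx0.
  have : cb (piece (A `\ x0) q (q x)) b x.
    by apply/(cone_cb_piece wf cA) => //; exact: cb_sub bx.
  by rewrite (rA (q x)).1.
apply/cbE; split=> [|c cb]; first by case: cA.
apply/(cone_limit wf cA) => G FG; have [n Gn] := filter_ex FG.
by exists n => //; exact: (rA n).2.
Qed.

Lemma rk_top1 (X : topologicalType) (A : set X) x0 a b : is_succ a b ->
  cb A b = [set x0] -> rk A a.
Proof.
move=> ab Ab; split=> [|c /(proj2 ab) cb]; last first.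
  by exists x0; apply: (cb_anti cb); rewrite Ab.
apply/eqP/negPn/negP => /set0P[x ax]; have := cb_anti (ltW (succ_lt ab)) ax.
rewrite Ab => /= xx0; move: ax; rewrite xx0 => /cbE[_ /(_ _ (succ_lt ab))].
by rewrite Ab => /(_ _ filterT)[y [/eqP]].
Qed.

Lemma rk_T a : rk [set: T a] a.
Proof.
elim/(well_founded_ind wf): a => a IH.
case: (ord_cases a) => [za|[b ab]|la].
- rewrite (T_zero wf FF za); split=> [|b]; last by rewrite (negPf (za b)).
  by rewrite cb_zero.
- have [zb|nzb] := pselect (is_zero b).
    have [x ->] := T_one wf FF ab zb.
    by apply: (rk_top1 (x0 := x) ab); rewrite cb_zero.
  have [x0 [q [cT pT]]] := T_succ wf FF ab nzb.
  apply: (rk_top1 ab); apply: (cone_rank_top cT) => n.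
  by apply: homeo_rk (homeo_sym (pT n)) _; apply: IH; exact: succ_lt.
- have [q [lq qa pT]] := T_limit wf FF la.
  have rp b : b < a -> rk (piece [set: T a] q b) b.
    by move=> ba; apply: homeo_rk (homeo_sym (pT _ ba)) (IH _ ba).
  split=> [|b ba].
    apply/eqP/negPn/negP => /set0P[x ax].
    have := cb_anti (ltW (qa x)) ax; rewrite (cb_piece _ _ lq)//.
    by rewrite (rp _ (qa x)).1.
  have [c bc ca] := la.2 _ ba; have [x bx] := (rp _ ca).2 _ bc.
  by exists x; apply: cbS bx; exact: piece_sub.
Qed.

Lemma homeo_T_rk (X : topologicalType) (A : set X) a :
  A ~= [set: T a] -> rk A a.
Proof. by move=> /homeo_sym AT; apply: homeo_rk AT (rk_T a). Qed.

Lemma T_top a b : is_succ a b -> exists x0, cb [set: T a] b = [set x0].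
Proof.
move=> ab; have [zb|nzb] := pselect (is_zero b).
  by have [x Tx] := T_one wf FF ab zb; exists x; rewrite cb_zero.
have [x0 [q [cT pT]]] := T_succ wf FF ab nzb; exists x0.
by apply: cone_rank_top cT _ => n; exact: homeo_T_rk.
Qed.

Context (F_homogeneous : homogeneous_filter F).
Context (F_times : filter_iso setT F setT (filter_times_omega F)).

(** The set of indices of nonempty pieces is positive because [x0] is not
isolated; homogeneity reindexes it by all of nat without changing the filter. *)
Lemma cone_T (X : topologicalType) (A : set X) x0 q a b :
  is_succ a b -> ~ is_zero b -> cone F A x0 q ->
  (forall n, piece (A `\ x0) q n = set0 \/ piece (A `\ x0) q n ~= [set: T b]) ->
  limit_point A x0 -> A ~= [set: T a].
Proof.
move=> ab nzb cA pA lx; have [Ax0 lq _ AF _] := cA.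
pose Z := [set n | piece (A `\ x0) q n !=set0].
have Zq y : (A `\ x0) y -> Z (q y) by exists y.
have Zpos : positive F Z.
  move=> G /AF/lx[y [/eqP yx0 Ay Gy]]; exists (q y).
  by split; [exact: Zq|apply: Gy].
have [t [tinj tsurj [t1 t2]]] := positive_iso FF F_homogeneous Zpos.
have cA' : cone F A x0 (t \o q).
  apply: cone_regroup cA _ _ _; first exact: locconst_comp.
    by move=> G /t1 FG; eexists; first exact: FG; move=> y Ay; apply; exact: Zq.
  move=> G /t2 FG; eexists; first exact: FG.
  by move=> y Ay; apply=> //; exact: Zq.
have [y0 [p [cT pT]]] := T_succ wf FF ab nzb.
apply: (homeo_cone cA' cT) => m; apply: homeo_trans (homeo_sym (pT m)).
have [n Zn tn] := tsurj m.
have -> : piece (A `\ x0) (t \o q) m = piece (A `\ x0) q n.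
  rewrite predeqE => y; split=> -[Ay qy]; split=> //; last by rewrite /= qy.
  by apply: tinj => //; [exact: Zq|rewrite tn].
by case: (pA n) => // p0; move: Zn; rewrite /Z /= p0 => -[].
Qed.

Definition sum_of_copies (b : O) (X : topologicalType) (A : set X) :=
  exists2 q : X -> nat, locconst A q &
    forall i, piece A q i = set0 \/ piece A q i ~= [set: T b].

Lemma sum_of_copies_T (X : topologicalType) (A : set X) b :
  A ~= [set: T b] -> sum_of_copies b A.
Proof.
move=> AT; exists (fun=> 0%N); first by move=> x _; exact: filterE.
by move=> [|i]; [right; rewrite piece_const|left; exact: piece_const0].
Qed.

(** Splitting each piece into its copies of T_b gives a cone over F x omega,
which is a cone over [F] in disguise. *)
Lemma cone_sum_T (X : topologicalType) (A : set X) x0 q a b :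
  is_succ a b -> ~ is_zero b -> cone F A x0 q ->
  (forall n, sum_of_copies b (piece (A `\ x0) q n)) ->
  limit_point A x0 -> A ~= [set: T a].
Proof.
move=> ab nzb cA pA lx; have [Ax0 lq _ AF _] := cA.
have /choice[r hr] n : exists r : X -> nat,
    locconst (piece (A `\ x0) q n) r /\ forall i,
    piece (piece (A `\ x0) q n) r i = set0 \/
    piece (piece (A `\ x0) q n) r i ~= [set: T b].
  by have [r] := pA n; exists r.
have [t [tinj tsurj [t1 t2]]] := times_iso FF F_times.
have [u ut] := choice tsurj.
have cA' : cone F A x0 (fun y => u (q y, r (q y) y)).
  apply: cone_regroup cA _ _ _.
  - apply: (locconst_refine (p := fun n y => u (n, r n y)) lq) => n.
    exact: (locconst_comp (fun k => u (n, k)) (hr n).1).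
  - move=> G /t2 FG; eexists; first exact: FG.
    by move=> y Ay /=; apply=> //; rewrite /= ut.
  - move=> G /t1 FG; eexists; first exact: FG.
    by move=> y Ay /= /(_ I); rewrite ut.
apply: cone_T ab nzb cA' _ lx => m.
suff -> : piece (A `\ x0) (fun y => u (q y, r (q y) y)) m =
    piece (piece (A `\ x0) q (t m).1) (r (t m).1) (t m).2.
  exact: (hr _).2.
rewrite predeqE => y; split=> [[Ay <-]|[[Ay qy] ry]]; first by rewrite ut.
split=> //; rewrite qy ry; apply: tinj; rewrite ut.
by case: (t m).
Qed.

End toronto_cones.

(** * Decomposable sets and their classification *)

Section classification.
Context {d : Order.disp_t} {O : orderType d}.
Local Open Scope order_scope.
Context (wf : well_founded (fun x y : O => x < y)).
Context (F : set_system nat) (FF : ProperFilter F).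
Local Notation T := (toronto_space wf FF).
Local Notation cb := (cb wf).
Local Notation rk := (rk wf).
Local Notation sum_of_copies := (sum_of_copies wf FF).

(** The index [s i] may be zero, which accounts for empty pieces.  Limits are
excluded because T_a with [a] a limit is itself a sum of smaller spaces; with
this choice a limit rank of the sum is never attained by one of the pieces. *)
Definition decomposable (X : topologicalType) (A : set X) :=
  exists (q : X -> nat) (s : nat -> O), locconst A q /\
    forall i, ~ is_limit (s i) /\ piece A q i ~= [set: T (s i)].

Lemma sub_countable_ord (a b : O) : b < a -> countable [set c : O | c < a] ->
  countable [set c : O | c < b].
Proof.
move=> ba; apply: sub_countable; apply: subset_card_le => c /= cb.
exact: lt_trans cb ba.
Qed.

Lemma zero_nlimit (a : O) : is_zero a -> ~ is_limit a.
Proof. by move=> za /limit_nzero. Qed.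

Lemma decomposable_nlimit (X : topologicalType) (A : set X) a : ~ is_limit a ->
  A ~= [set: T a] -> decomposable A.
Proof.
move=> nla AT; have [z zz] := ex_zero wf a.
exists (fun=> 0%N), (fun i => if i is 0%N then a else z); split.
  by move=> x _; exact: filterE.
move=> [|i]; first by rewrite piece_const.
split; first exact: zero_nlimit.
by apply: homeo0; [rewrite piece_const0|exact: T_zero].
Qed.

Lemma decomposable0 (X : topologicalType) (A : set X) (a : O) :
  A = set0 -> decomposable A.
Proof.
move=> A0; have [z zz] := ex_zero wf a.
apply: (decomposable_nlimit (zero_nlimit zz)).
by apply: homeo0 => //; exact: T_zero.
Qed.

Lemma decomposable_homeo (X Y : topologicalType) (A : set X) (B : set Y) :
  A ~= B -> decomposable B -> decomposable A.
Proof.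
move=> [R hR] [q [s [lq qs]]]; have [p Rpq] := hrel_fun 0%N q hR.
exists p, s; split; first exact: locconst_transport hR Rpq lq.
move=> i; split; first exact: (qs i).1.
exact: homeo_trans (piece_transport i hR Rpq) (qs i).2.
Qed.

Lemma decomposable_sum (I : countType) (i0 : I) (X : topologicalType)
    (A : set X) (p : X -> I) :
  locconst A p -> (forall i, decomposable (piece A p i)) -> decomposable A.
Proof.
move=> lp /choice[q /choice[s qs]]; have [z zz] := ex_zero wf (s i0 0%N).
exists (fun x => pickle (p x, q (p x) x)).
exists (fun n => if pickle_inv n is Some (i, k) then s i k else z); split.
  apply: (locconst_refine (p := fun i x => pickle (i, q i x)) lp) => i.
  exact: (locconst_comp (fun k => pickle (i, k)) (qs i).1).
move=> n; case E : (pickle_inv n) => [[i k]|]; last first.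
  split; first exact: zero_nlimit.
  apply: homeo0; last exact: T_zero.
  rewrite predeqE => x; split=> // -[Ax xn].
  by move: E; rewrite -xn pickleK_inv.
have nE : pickle (i, k) = n.
  by have := @pickle_invK (I * nat)%type n; rewrite /oapp E.
suff -> : piece A (fun x => pickle (p x, q (p x) x)) n =
    piece (piece A p i) (q i) k by exact: (qs i).2.
rewrite predeqE => x; split=> [[Ax]|[[Ax px] qx]]; last first.
  by split=> //; rewrite px qx.
rewrite -nE => /(pcan_inj pickleK)[px qx]; split; first by split.
by rewrite -px.
Qed.

Lemma decomposable_select (X : topologicalType) (A : set X) (q : X -> nat)
    (s : nat -> O) (P : pred nat) :
  locconst A q ->
  (forall i, ~ is_limit (s i) /\ piece A q i ~= [set: T (s i)]) ->
  decomposable [set x | A x /\ P (q x)].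
Proof.
move=> lq qs; have [z zz] := ex_zero wf (s 0%N).
exists q, (fun i => if P i then s i else z); split.
  by apply: locconst_sub lq => x [].
move=> i; case: ifPn => Pi.
  suff -> : piece [set x | A x /\ P (q x)] q i = piece A q i by exact: qs.
  by rewrite predeqE => x; split=> [[[]]|[Ax qx]] //; split=> //=; rewrite qx.
split; first exact: zero_nlimit.
apply: homeo0; last exact: T_zero.
by rewrite predeqE => x; split=> // -[[/= Ax +] qx]; rewrite qx (negPf Pi).
Qed.

Lemma decomposable_T a :
  countable [set b : O | b < a] -> decomposable [set: T a].
Proof.
elim/(well_founded_ind wf): a => a IH ca.
have [la|] := pselect (is_limit a); last first.
  by move=> nla; exact: decomposable_nlimit nla (homeo_refl _).
have [q [lq qa qT]] := T_limit wf FF la.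
have /countable_injP[f finj] := ca.
apply: (decomposable_sum (I := nat) 0%N (p := f \o q)).
  exact: locconst_comp.
move=> i; have [[b ba fb]|nb] := pselect (exists2 b, b < a & f b = i).
  suff -> : piece [set: T a] (f \o q) i = piece [set: T a] q b.
    exact: decomposable_homeo (qT _ ba) (IH _ ba (sub_countable_ord ba ca)).
  rewrite predeqE => x; split=> -[_ /= qx]; split=> //; last by rewrite /= qx.
  by apply: finj; rewrite ?inE //= ?qa// fb.
apply: (decomposable0 a); rewrite predeqE => x; split=> // -[_ /= fx].
by apply: nb; exists (q x).
Qed.

Lemma T_cb0 (X : topologicalType) (A : set X) s c :
  A ~= [set: T s] -> s <= c -> cb A c = set0.
Proof.
move=> /homeo_T_rk [As _] sc; apply/eqP/negPn/negP => /set0P[x].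
by move=> /(cb_anti sc); rewrite As.
Qed.

Lemma T_cb_lt (X : topologicalType) (A : set X) s c :
  A ~= [set: T s] -> cb A c !=set0 -> c < s.
Proof.
move=> AT [x cx]; rewrite ltNge; apply/negP => /(T_cb0 AT) e.
by rewrite e in cx.
Qed.

Lemma cb_sum_eq0 (X : topologicalType) (I : Type) (A : set X) (q : X -> I) c :
  locconst A q -> (forall i, cb (piece A q i) c = set0) -> cb A c = set0.
Proof.
move=> lq h; apply/eqP/negPn/negP => /set0P/(cb_sum0 wf c lq)[i].
by rewrite h => -[].
Qed.

Lemma cb_sub_eq0 (X : topologicalType) (A B : set X) c :
  A `<=` B -> cb B c = set0 -> cb A c = set0.
Proof. by move=> AB B0; rewrite -subset0 -B0; exact: cbS. Qed.

Lemma piece_rk_le (X : topologicalType) (A : set X) (q : X -> nat) a s i :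
  rk A a -> piece A q i ~= [set: T s] -> s <= a.
Proof.
move=> [A0 _] pT; apply: (rk_le (homeo_T_rk pT)).
by apply: cb_sub_eq0 A0; exact: piece_sub.
Qed.

(** Each nonempty piece contains a point of the [b]-th derivative, so there is
only one. *)
Lemma sum_of_copies_single (X : topologicalType) (A : set X) a b x0 :
  is_succ a b -> sum_of_copies a A -> cb A b = [set x0] -> A ~= [set: T a].
Proof.
move=> ab [q lq qT] Ab.
have qc y : A y -> piece A q (q y) ~= [set: T a] /\ q y = q x0.
  move=> Ay; have yT : piece A q (q y) ~= [set: T a].
    case: (qT (q y)) => // p0.
    by have : piece A q (q y) y by []; rewrite p0.
  split=> //; have [z bz] := (homeo_T_rk yT).2 _ (succ_lt ab).
  have [_ <-] := cb_sub bz; congr q.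
  by have := cbS (@piece_sub _ _ _ _ _) bz; rewrite Ab.
have Ax0 : A x0 by apply: (@cb_sub _ _ wf _ _ b); rewrite Ab.
suff -> : A = piece A q (q x0) by exact: (qc _ Ax0).1.
by rewrite predeqE => y; split=> [Ay|[]//]; split=> //; exact: (qc _ Ay).2.
Qed.

Context (F_homogeneous : homogeneous_filter F).
Context (F_times : filter_iso setT F setT (filter_times_omega F)).

(** Intended for [a] the successor of [b]: T_a absorbs all decomposable sets of
rank at most [b]. *)
Definition absorbs (a b : O) :=
  forall (X : topologicalType) (C : set X) (p : X -> bool),
  locconst C p -> piece C p true ~= [set: T a] ->
  decomposable (piece C p false) ->
  cb (piece C p false) b = set0 -> C ~= [set: T a].

Definition classified (a : O) := forall (X : topologicalType) (A : set X),
  decomposable A -> rk A a ->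
  sum_of_copies a A /\ (is_limit a -> A ~= [set: T a]).

(** The set to be absorbed is added to the piece of index 0 of T_a, seen as a
cone; this does not affect the neighbourhoods of the apex, since [F] is free,
and the enlarged piece is a sum of copies of T_b by the classification at [b].
*)
Lemma absorbs_succ a b : is_succ a b -> countable [set c : O | c < a] ->
  classified b -> absorbs a b.
Proof.
move=> ab ca clb X C p lp CtT Cfdec Cf0.
have [zb|nzb] := pselect (is_zero b).
  suff -> : C = piece C p true by [].
  rewrite predeqE => x; split=> [Cx|[]//]; split=> //.
  apply/negPn/negP => /negPf px.
  have : piece C p false x by [].
  by rewrite -(cb_zero wf (piece C p false) zb) Cf0.
have [y0 [r [cT rT]]] := T_succ wf FF ab nzb.
have [x0 [q [cC qrT]]] := cone_transport 0%N CtT cT.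
have qT n : piece (piece C p true `\ x0) q n ~= [set: T b].
  exact: homeo_trans (qrT n) (rT n).
have [[Cx0 px0] lq C0 CF FC] := cC.
pose q' y := if p y then q y else 0%N.
have lq' : locconst (C `\ x0) q'.
  have lp' : locconst (C `\ x0) p by apply: locconst_sub lp; exact: subDsetl.
  apply: (locconst_refine
    (p := fun (c : bool) y => if c then q y else 0%N) lp').
  move=> [|]; first by apply: locconst_sub lq => x [[? ?] ?].
  by move=> x _; exact: filterE.
have cC' : cone F C x0 q'.
  split=> //.
  - move=> x [Cx xx0]; case px : (p x); first exact: C0.
    apply: filterS (lp _ Cx) => y /= py yx0; subst y.
    by move: (py Cx0); rewrite px0 px.
  - move=> G /CF nG; apply: filterS2 nG (lp _ Cx0) => y h1 h2 [Cy yx0].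
    have py : p y by rewrite h2.
    by rewrite /q' py; exact: h1.
  - move=> U /FC[G FG GU]; exists (G `&` [set n | n <> 0%N]).
      by apply: filterI => //; exact: filter_free.
    move=> y [Cy yx0] [Gy]; rewrite /q'; case: ifPn => // py _.
    by apply: GU => //; move: Gy; rewrite /q' py.
have q'E y : C y -> p y -> q' y = q y by rewrite /q' => _ ->.
apply: (cone_sum_T F_homogeneous F_times ab nzb cC').
  move=> n; have [->|n0] := eqVneq n 0%N; last first.
    suff -> : piece (C `\ x0) q' n = piece (piece C p true `\ x0) q n.
      exact: sum_of_copies_T.
    rewrite predeqE => x; rewrite /piece /= /q'; split.
      move=> [[Cx xx0]]; case: ifPn => px qx; first by do ?split.
      by rewrite qx eqxx in n0.
    by move=> [[[Cx px] xx0] <-]; rewrite px.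
  set E := piece _ _ _.
  have lE : locconst E p by apply: locconst_sub lp => x [[]].
  have Et : piece E p true = piece (piece C p true `\ x0) q 0%N.
    rewrite predeqE => x; rewrite /E /piece /= /q'; split.
      by move=> [[[Cx xx0] + px]]; rewrite px.
    by move=> [[[Cx px] xx0]]; rewrite px.
  have Ef : piece E p false = piece C p false.
    rewrite predeqE => x; rewrite /E /piece /= /q'; split.
      by move=> [[[Cx xx0] + px]].
    move=> [Cx px]; rewrite px; split=> //; split=> //; split=> // xx0.
    by move: px; rewrite xx0 px0.
  have decE : decomposable E.
    apply: (decomposable_sum (I := bool) true lE) => -[|]; last by rewrite Ef.
    rewrite Et; apply: decomposable_homeo (qT _) (decomposable_T _).
    exact: sub_countable_ord (succ_lt ab) ca.
  have rE : rk E b.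
    split=> [|c cb].
      apply: (cb_sum_eq0 lE) => -[|]; last by rewrite Ef.
      by rewrite Et; exact: T_cb0 (qT _) _.
    have [x cx] := (homeo_T_rk (qT 0%N)).2 _ cb; exists x.
    by apply: cbS cx; rewrite -Et; exact: piece_sub.
  exact: (clb _ _ decE rE).1.
have [z zz] := ex_zero wf a.
rewrite -(cb_zero wf C zz); apply/(cone_limit wf cC') => G FG.
have /filter_ex[n [Gn n0]] : F (G `&` [set n | n <> 0%N]).
  by apply: filterI => //; exact: filter_free.
exists n => //; rewrite cb_zero//.
have [x [[[Cx px] xx0] qx]] := rk_nonempty nzb (homeo_T_rk (qT n)).
by exists x; split=> //; rewrite q'E.
Qed.

(** Some piece is a copy of T_a, since the [b]-th derivative is not empty; it
absorbs all the pieces that are not copies of T_a. *)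
Lemma sum_of_copies_succ a b (X : topologicalType) (A : set X) :
  is_succ a b -> absorbs a b -> decomposable A -> rk A a -> sum_of_copies a A.
Proof.
move=> ab abs [q [s [lq qs]]] rA.
have sa i : s i <= a by exact: piece_rk_le rA (qs i).2.
have [i0 bi0] : exists i0, s i0 = a.
  have /(cb_sum0 wf b lq)[i /(T_cb_lt (qs i).2) bs] := rA.2 _ (succ_lt ab).
  by exists i; apply/le_anti; rewrite sa (succ_le ab bs).
pose q' y := if s (q y) == a then q y else i0.
have lq' : locconst A q'.
  exact: (locconst_comp (fun i => if s i == a then i else i0) lq).
exists q' => // i; have [->|ii0] := eqVneq i i0; last first.
  have [sia|sia] := eqVneq (s i) a.
    right; suff -> : piece A q' i = piece A q i.
      by rewrite -sia; exact: (qs i).2.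
    rewrite predeqE => x; rewrite /piece /= /q'; split=> -[Ax].
      by case: ifPn => // _ e; rewrite e eqxx in ii0.
    by move=> ->; rewrite sia eqxx.
  left; rewrite predeqE => x; rewrite /piece /= /q'; split=> // -[Ax].
  case: ifPn => [sx e|_ e]; first by rewrite -e sx in sia.
  by rewrite e eqxx in ii0.
right; pose P j := (j != i0) && (s j != a).
have lp : locconst (piece A q' i0) (fun y => q y == i0).
  apply: (locconst_comp (fun j => j == i0)).
  by apply: locconst_sub lq; exact: piece_sub.
apply: (abs _ _ _ lp).
- suff -> : piece (piece A q' i0) (fun y => q y == i0) true = piece A q i0.
    by have := (qs i0).2; rewrite bi0.
  rewrite predeqE => x; rewrite /piece /= /q'; split.
    by move=> [[Ax _] /eqP].
  by move=> [Ax ->]; rewrite bi0 !eqxx.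
- suff -> : piece (piece A q' i0) (fun y => q y == i0) false =
    [set x | A x /\ P (q x)] by exact: decomposable_select lq qs.
  rewrite predeqE => x; rewrite /piece /= /q' /P; split.
    move=> [[Ax +] xi0]; rewrite xi0; case: eqP => // _ e.
    by rewrite e eqxx in xi0.
  by move=> [Ax /andP[/negPf xi0 /negPf sx]]; rewrite xi0 sx.
- have lf : locconst (piece (piece A q' i0) (fun y => q y == i0) false) q.
    by apply: locconst_sub lq => x [[]].
  apply: (cb_sum_eq0 lf) => j; have [sja|sja] := eqVneq (s j) a.
    apply: (@cb_sub_eq0 _ _ set0); last by rewrite -subset0; exact: cb_sub.
    move=> x [[[Ax]]]; rewrite /q' => + /eqP xi0 xj.
    by rewrite xj sja eqxx -xj => /xi0.
  apply: (@cb_sub_eq0 _ _ (piece A q j)); first by move=> x [[[? _] _]].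
  apply: (T_cb0 (qs j).2); apply: ab.2.
  by rewrite lt_neqAle sja sa.
Qed.

(** Since the ranks of the pieces of the first part are cofinal in [a], the
pieces of the second part can be assigned injectively to pieces of the first
part of larger rank, each of which absorbs the piece assigned to it. *)
Lemma absorbs_limit a (X : topologicalType) (C : set X) (p : X -> bool) :
  is_limit a -> (forall s b, s < a -> is_succ s b -> absorbs s b) ->
  locconst C p ->
  decomposable (piece C p true) -> rk (piece C p true) a ->
  decomposable (piece C p false) -> rk (piece C p false) a ->
  C ~= piece C p true.
Proof.
move=> la abs lp; set A := piece C p true; set B := piece C p false.
move=> [q [s [lq qs]]] rA [r [t [lr rt]]] rB.
have ta k : t k < a.
  rewrite lt_neqAle (piece_rk_le rB (rt k).2) andbT; apply/eqP => tka.
  by apply: (rt k).1; rewrite tka.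
have sa k : s k < a.
  rewrite lt_neqAle (piece_rk_le rA (qs k).2) andbT; apply/eqP => ska.
  by apply: (qs k).1; rewrite ska.
have /choice[h hP] c : exists i, c < a -> c < s i.
  have [ca|nca] := pselect (c < a); last by exists 0%N.
  have /(cb_sum0 wf c lq)[i /(T_cb_lt (qs i).2) cs] := rA.2 _ ca.
  by exists i.
(* asking also that [s] increases strictly along [g] makes [g] injective *)
pose g := fix g k :=
  if k is j.+1 then h (Order.max (t k) (s (g j))) else h (t k).
have gt k : t k < s (g k).
  case: k => [|k] /=; first exact: hP.
  apply: le_lt_trans (hP _ _); first by rewrite le_max lexx.
  by rewrite gt_max ta sa.
have gs k : s (g k) < s (g k.+1).
  rewrite [g k.+1]/=; apply: le_lt_trans (hP _ _).
    by rewrite le_max lexx orbT.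
  by rewrite gt_max ta sa.
have ginj : injective g.
  have mono : {homo (s \o g) : m n / (m < n)%N >-> m < n}.
    by apply: homo_ltn => //; exact: lt_trans.
  by move=> m n e; case: (ltngtP m n) => // /mono /=; rewrite e ltxx.
pose q' y := if p y then q y else g (r y).
have lq' : locconst C q'.
  apply: (locconst_refine
    (p := fun (c : bool) y => if c then q y else g (r y)) lp).
  move=> [|]; first exact: lq.
  exact: (locconst_comp g lr).
apply: (homeo_glue lq' lq) => i.
have lpi : locconst (piece C q' i) p.
  by apply: locconst_sub lp; exact: piece_sub.
have it : piece (piece C q' i) p true = piece A q i.
  rewrite predeqE => x; rewrite /A /piece /= /q'; split.
    by move=> [[Cx + px]]; rewrite px.
  by move=> [[Cx px]]; rewrite px.
have [[k ki]|nk] := pselect (exists k, g k = i); last first.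
  suff <- : piece (piece C q' i) p true = piece C q' i.
    by rewrite it; exact: homeo_refl.
  rewrite predeqE => x; rewrite /A /piece /= /q'; split=> [[]//|[Cx]].
  by case: ifPn => // _ e; case: nk; exists (r x).
have ift : piece (piece C q' i) p false = piece B r k.
  rewrite predeqE => x; rewrite /B /piece /= /q'; split.
    by move=> [[Cx + px]]; rewrite px -ki => /ginj.
  by move=> [[Cx px]]; rewrite px => ->.
have [b ib] : exists b, is_succ (s i) b.
  case: (ord_cases (s i)) => // [zi|/(qs i).1//].
  by have := zi (t k); rewrite -ki gt.
apply: homeo_trans (homeo_sym (qs i).2).
apply: (abs _ _ (sa i) ib _ _ _ lpi); first by rewrite it; exact: (qs i).2.
  by rewrite ift; exact: decomposable_nlimit (rt k).1 (rt k).2.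
by rewrite ift; apply: (T_cb0 (rt k).2); apply: ib.2; rewrite -ki gt.
Qed.

(** Both [A] and [B] absorb the other one, so each is homeomorphic to their
disjoint sum. *)
Lemma decomposable_limit a (X Y : topologicalType) (A : set X) (B : set Y) :
  is_limit a -> (forall s b, s < a -> is_succ s b -> absorbs s b) ->
  decomposable A -> rk A a -> decomposable B -> rk B a -> A ~= B.
Proof.
move=> la abs dA rA dB rB.
pose Z b : topologicalType := if b then X else Y.
have [A' sA AA'] := homeo_sub (homeo_sym (sigT_piece Z true)) (@subsetT _ A).
have [B' sB BB'] := homeo_sub (homeo_sym (sigT_piece Z false)) (@subsetT _ B).
pose C := A' `|` B'; pose p : {b & Z b} -> bool := @projT1 _ _.
have lp : locconst C p by apply: locconst_sub (@sigT_locconst _ Z).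
have lnp : locconst C (negb \o p) by exact: locconst_comp.
have Ct : piece C p true = A'.
  rewrite predeqE => x; split=> [[[//|/sB[_]]]|A'x]; first by rewrite /p => ->.
  by split; [left|case: (sA _ A'x)].
have Cf : piece C p false = B'.
  rewrite predeqE => x; split=> [[[/sA[_]|//]]|B'x]; first by rewrite /p => ->.
  by split; [right|case: (sB _ B'x)].
have Ct' : piece C (negb \o p) true = B'.
  by rewrite -Cf predeqE => x; split=> -[Cx /= px]; split=> //=;
    move: px; case: (p x).
have Cf' : piece C (negb \o p) false = A'.
  by rewrite -Ct predeqE => x; split=> -[Cx /= px]; split=> //=;
    move: px; case: (p x).
have dA' : decomposable A' by apply: decomposable_homeo dA; exact: homeo_sym.
have dB' : decomposable B' by apply: decomposable_homeo dB; exact: homeo_sym.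
have rA' := homeo_rk AA' rA; have rB' := homeo_rk BB' rB.
apply: homeo_trans AA' _; apply: homeo_trans (homeo_sym BB').
apply: (@homeo_trans _ _ _ _ C).
  by apply: homeo_sym; rewrite -Ct; apply: absorbs_limit la abs lp _ _ _ _;
    rewrite ?Ct ?Cf.
by rewrite -Ct'; apply: absorbs_limit la abs lnp _ _ _ _; rewrite ?Ct' ?Cf'.
Qed.

Theorem classification a : countable [set b : O | b < a] -> classified a.
Proof.
elim/(well_founded_ind wf): a => a IH ca X A dA rA.
have abs s b : s <= a -> is_succ s b -> absorbs s b.
  move=> sa sb; have ba : b < a := lt_le_trans (succ_lt sb) sa.
  apply: absorbs_succ sb _ (IH _ ba (sub_countable_ord ba ca)).
  move: sa; rewrite le_eqVlt => /orP[/eqP ->//|sa].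
  exact: sub_countable_ord sa ca.
case: (ord_cases a) => [za|[b ab]|la].
- split; last by move=> /limit_nzero.
  by apply: sum_of_copies_T; apply: homeo0; [exact: rk_zero rA|exact: T_zero].
- split; last by move=> /limit_succ/(_ ab).
  by apply: sum_of_copies_succ ab (abs _ _ _ ab) dA rA.
- suff AT : A ~= [set: T a] by split=> // ; exact: sum_of_copies_T.
  apply: (decomposable_limit la _ dA rA (decomposable_T ca) (rk_T wf FF a)).
  by move=> s b sa; apply: abs; exact: ltW.
Qed.

End classification.

(** * Subspaces of T_a *)

Lemma filter_gt (F : set_system nat) (FF : ProperFilter F) m :
  homogeneous_filter F -> F [set n | (m < n)%N].
Proof.
move=> hF; elim: m => [|m IH].
  by apply: filterS (filter_free FF hF 0) => -[].
apply: filterS2 IH (filter_free FF hF m.+1) => n /= mn nm.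
by rewrite ltn_neqAle mn andbT; apply/eqP => e; apply: nm.
Qed.

Lemma finite_to_one_le (Y : set nat) (f : nat -> nat) k :
  (forall m, finite_set (Y `&` f @^-1` [set m])) ->
  finite_set (Y `&` [set n | (f n <= k)%N]).
Proof.
move=> fY; elim: k => [|k IH].
  by apply: sub_finite_set (fY 0) => n [Yn /=]; rewrite leqn0 => /eqP.
have : finite_set (Y `&` [set n | (f n <= k)%N] `|` Y `&` f @^-1` [set k.+1]).
  by rewrite finite_setU.
apply: sub_finite_set => n [Yn /=]; rewrite leq_eqVlt => /orP[/eqP e|e].
  by right.
by left.
Qed.

Lemma homeo_countable (X Y : topologicalType) (A : set X) (B : set Y) :
  A ~= B -> countable B -> countable A.
Proof.
move=> [R hR] /countable_injP[q qinj]; have [p Rpq] := hrel_fun 0%N q hR.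
apply/countable_injP; exists p => x x' /set_mem Ax /set_mem Ax'.
have [[_ R2 _ _] [S1 _ S3 _]] := hR.
have [y Rxy] := R2 _ Ax; have [y' Rxy'] := R2 _ Ax'.
rewrite (Rpq _ _ Rxy) (Rpq _ _ Rxy') => /qinj e.
apply: (S3 y) => //; rewrite e//; apply: mem_set.
  exact: S1 Rxy.
exact: S1 Rxy'.
Qed.

Section toronto_theorem.
Context {d : Order.disp_t} {O : orderType d}.
Local Open Scope order_scope.
Context (wf : well_founded (fun x y : O => x < y)).
Context (F : set_system nat) (FF : ProperFilter F).
Local Notation T := (toronto_space wf FF).
Local Notation cb := (cb wf).
Local Notation rk := (rk wf).
Local Notation sum_of_copies := (sum_of_copies wf FF).
Local Notation decomposable := (decomposable wf FF).

Lemma cofinal_seq (g : O) : ~ is_zero g -> countable [set b : O | b < g] ->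
  exists e : nat -> O, [/\ forall k, e k < g,
    forall k l, (k <= l)%N -> e k <= e l &
    forall b, b < g -> exists k, b <= e k].
Proof.
move=> nzg /countable_injP[f finj]; have [z zz] := ex_zero wf g.
have zg : z < g by exact: zero_lt.
have /choice[h hP] k : exists b, b < g /\ forall c, c < g -> f c = k -> b = c.
  have [[b bg fb]|nb] := pselect (exists2 b, b < g & f b = k).
    exists b; split=> // c cg fc; apply: finj; rewrite ?inE//.
    by rewrite fb fc.
  by exists z; split=> // c cg fc; case: nb; exists c.
pose e := fix e k := if k is j.+1 then Order.max (h k) (e j) else h k.
exists e; split.
- elim=> [|k IH] /=; first exact: (hP _).1.
  by rewrite gt_max IH (hP _).1.
- apply: (@homo_leq _ e <=%O) => //; first by move=> y x v; exact: le_trans.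
  by move=> k /=; rewrite le_max lexx orbT.
- move=> b bg; exists (f b); rewrite -[X in X <= _]((hP (f b)).2 b bg erefl).
  by case: (f b) => //= k; rewrite le_max lexx.
Qed.

Lemma countable_T a : countable [set b : O | b < a] -> countable [set: T a].
Proof.
elim/(well_founded_ind wf): a => a IH ca.
case: (ord_cases a) => [za|[b ab]|la].
- by rewrite (T_zero wf FF za).
- have [zb|nzb] := pselect (is_zero b).
    have [x ->] := T_one wf FF ab zb; exact: countable1.
  have [x0 [q [_ qT]]] := T_succ wf FF ab nzb.
  have -> : [set: T a] =
      \bigcup_n if n is m.+1 then piece ([set: T a] `\ x0) q m else [set x0].
    rewrite predeqE => x; split=> // _.
    by have [->|xx0] := pselect (x = x0); [exists 0%N|exists (q x).+1].
  apply: bigcup_countable => // -[|n] _; first exact: countable1.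
  apply: homeo_countable (qT n) _.
  by apply: IH (succ_lt ab) _; exact: sub_countable_ord (succ_lt ab) ca.
- have [q [lq qa qT]] := T_limit wf FF la.
  have -> : [set: T a] = \bigcup_(b in [set b | b < a]) piece [set: T a] q b.
    by rewrite predeqE => x; split=> // _; exists (q x) => //=.
  apply: bigcup_countable => // b ba; apply: homeo_countable (qT b ba) _.
  exact: (IH _ ba (sub_countable_ord ba ca)).
Qed.

Context (F_homogeneous : homogeneous_filter F).
Context (F_times : filter_iso setT F setT (filter_times_omega F)).
Context (F_finite_to_one : finite_to_one_property F).

(** The function [f] of the proof has value [n] if the [n]-th piece has rank
[g], and otherwise locates the rank of this piece on a sequence cofinal in [g].  With
this choice no case distinction is made between [g] successor and limit, or
between few and many pieces of rank [g]: in all cases, infinitely many indices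
on which [f] is finite-to-one give pieces whose union has rank [g]. *)
Lemma cone_decomposable_T (X : topologicalType) (A : set X) x0 q c g :
  is_succ c g -> countable [set b : O | b < g] ->
  cone F A x0 q -> (forall n, decomposable (piece (A `\ x0) q n)) ->
  cb A g x0 -> (forall n, cb (piece (A `\ x0) q n) g = set0) ->
  A ~= [set: T c].
Proof.
move=> cg ctg cA; set P := piece (A `\ x0) q => dP gx0 Pg.
have [zg|nzg] := pselect (is_zero g).
  have [x ->] := T_one wf FF cg zg.
  suff -> : A = [set x0] by exact: homeo1.
  rewrite predeqE => y; split=> [Ay|->]; last by case: cA.
  apply: contrapT => yx0; have : P (q y) y by [].
  by rewrite -(cb_zero wf (P (q y)) zg) Pg.
have [e [eg emono ecof]] := cofinal_seq nzg ctg.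
pose full n := forall b, b < g -> cb (P n) b !=set0.
have /choice[f fP] n : exists k, (full n -> k = n) /\ (~ full n ->
    cb (P n) (e k) = set0 /\ forall j, (j < k)%N -> cb (P n) (e j) !=set0).
  have [fn|nfn] := pselect (full n); first by exists n.
  have ex : exists k, `[< cb (P n) (e k) = set0 >].
    move/existsNP: nfn => [b /not_implyP[bg /set0P/negP/negPn/eqP b0]].
    have [k bk] := ecof _ bg; exists k; apply/asboolP.
    by rewrite -subset0 -b0; exact: cb_anti.
  exists (ex_minn ex); split=> // _; case: ex_minnP => k /asboolP k0 kmin.
  split=> // j jk; apply/set0P/negP => /eqP j0.
  by have := kmin j; rewrite leqNgt jk; move=> /(_ (asboolT j0)).
have funb G : F G -> forall m, exists2 n, G n & (m < f n)%N.
  move=> FG m.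
  have FG' : F (G `&` [set n | (m < n)%N]).
    by apply: filterI => //; exact: filter_gt.
  have lx : limit_point (cb A (e m)) x0 by case/cbE: gx0 => _; exact.
  (* the apex is a limit of points of rank at least [e m]; an index above [m] of
     such a point witnesses that [f] exceeds [m], also if its piece has rank [g]
  *)
  have [n [Gn mn] nm] := (cone_limit wf cA (e m)).1 lx _ FG'.
  exists n => //; have [fn|nfn] := pselect (full n); first by rewrite (fP n).1.
  rewrite ltnNge; apply/negP => fnm; have [fn0 _] := (fP n).2 nfn.
  have [y /(cb_anti (emono _ _ fnm))] := nm.
  by rewrite fn0.
have [Y Ypos Yfin] := F_finite_to_one funb.
have [r [[r1 r2] rinf]] := filter_regroup FF F_homogeneous F_times Ypos.
have [_ lq _ _ _] := cA.
have cA' : cone F A x0 (r \o q).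
  apply: cone_regroup cA _ _ _.
  - exact: locconst_comp.
  - by move=> G /r1 FG; eexists; first exact: FG; move=> y _; exact.
  - by move=> G /r2 FG; eexists; first exact: FG; move=> y _ /=; exact.
apply: (cone_sum_T F_homogeneous F_times cg nzg cA').
  move=> m; set B := piece _ _ _.
  have lB : locconst B q.
    by apply: (@locconst_sub _ _ (A `\ x0)); [move=> y []|case: cA].
  have BP n : piece B q n `<=` P n by move=> y [[]].
  have BPr n : r n = m -> piece B q n = P n.
    move=> rn; rewrite predeqE => y; split=> [[[]]//|[Ay qy]].
    by split=> //; split=> //=; rewrite qy.
  have dB : decomposable B.
    apply: (decomposable_sum (I := nat) 0%N lB) => n.
    have [/BPr->//|rn] := pselect (r n = m).
    apply: (decomposable0 _ _ g); rewrite predeqE => y; split=> //.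
    by move=> -[[_ /= ry] qy]; apply: rn; rewrite -qy.
  have rB : rk B g.
    split=> [|b bg].
      by apply: (cb_sum_eq0 lB) => n; exact: cb_sub_eq0 (BP n) (Pg n).
    have [k bk] := ecof _ bg.
    have [n Yn kn] : exists2 n, (Y `&` r @^-1` [set m]) n & (k < f n)%N.
      apply: contrapT => h; apply: (rinf m).
      apply: sub_finite_set (finite_to_one_le k Yfin) => n [Yn rn].
      split=> //=; rewrite leqNgt; apply/negP => kn; apply: h.
      by exists n.
    suff [y bn] : cb (P n) b !=set0.
      by exists y; apply: cbS bn; rewrite -(BPr n Yn.2); exact: piece_sub.
    have [fn|nfn] := pselect (full n); first exact: fn.
    have [_ /(_ _ kn)[y ky]] := (fP n).2 nfn.
    by exists y; exact: cb_anti ky.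
  exact: (classification F_homogeneous F_times ctg dB rB).1.
have [z zz] := ex_zero wf g; have /cbE[_ /(_ _ (zero_lt nzg zz))] := gx0.
by rewrite cb_zero.
Qed.

Lemma decomposable_sub_T (X : topologicalType) (P A : set X) b :
  P ~= [set: T b] -> (forall B : set (T b), decomposable B) -> A `<=` P ->
  decomposable A.
Proof.
by move=> PT dT /(homeo_sub PT)[B _ AB]; apply: decomposable_homeo AB (dT B).
Qed.

(** In the main case [a] is a successor and [A] contains the apex of T_a, which
has some rank [g] in [A].  The points of [A] with index in a suitable member of
[F], together with the apex, form a clopen copy of T_(g+1); the other pieces are
subsets of copies of T_b, to which the induction hypothesis applies. *)
Theorem decomposable_subspace a (A : set (T a)) :
  countable [set b : O | b < a] -> decomposable A.
Proof.
elim/(well_founded_ind wf): a A => a IH A ca.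
have IH' b : b < a -> forall B : set (T b), decomposable B.
  by move=> ba B; exact: (IH _ ba B (sub_countable_ord ba ca)).
case: (ord_cases a) => [za|[b ab]|la].
- by apply: (decomposable0 _ _ a); rewrite -subset0 -(T_zero wf FF za).
- have [zb|nzb] := pselect (is_zero b).
    have [x Tx] := T_one wf FF ab zb.
    have : A `<=` [set x] by rewrite -Tx.
    move=> /subset_set1[->|->]; first exact: (decomposable0 _ _ a).
    by rewrite -Tx; exact: decomposable_T.
  have [x0 [q [cT qT]]] := T_succ wf FF ab nzb.
  have lT : locconst ([set: T a] `\ x0) q by case: cT.
  have dn n (B : set (T a)) :
      B `<=` piece ([set: T a] `\ x0) q n -> decomposable B.
    by apply: decomposable_sub_T (qT n) (IH' _ (succ_lt ab)).
  have [Ax0|nAx0] := pselect (A x0); last first.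
    apply: (decomposable_sum (I := nat) 0%N (p := q)).
      by apply: locconst_sub lT => y Ay; split=> // yx0; rewrite yx0 in Ay.
    move=> n; apply: (dn n) => y [Ay qy]; do !split=> //.
    by move=> yx0; rewrite yx0 in Ay.
  have cA : cone F A x0 q by apply: cone_sub cT.
  have [g0 g0a ng0] : exists2 g, g < a & ~ limit_point (cb A g) x0.
    apply: contrapT => h; have : cb A a x0.
      apply/cbE; split=> // c ca'; apply: contrapT => nc; apply: h.
      by exists c.
    by rewrite (cb_sub_eq0 (@subsetT _ A) (rk_T wf FF a).1).
  have [|g ng gmin] := wf_min wf (P := fun g => ~ limit_point (cb A g) x0).
    by exists g0.
  have ga : g < a := le_lt_trans (gmin _ ng0) g0a.
  have gx0 : cb A g x0.
    apply/cbE; split=> // c cg; apply: contrapT => nc; have := gmin _ nc.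
    by rewrite leNgt cg.
  have [c cg _] := ex_succ wf ga.
  have [G FG Gg] : exists2 G, F G & forall n, G n ->
      cb (piece (A `\ x0) q n) g = set0.
    apply: contrapT => h; apply: ng; apply/(cone_limit wf cA) => G FG.
    apply: contrapT => h'; apply: h; exists G => // n Gn.
    apply/eqP/negPn/negP => /set0P n0; apply: h'.
    by exists n.
  pose near_top y := y = x0 \/ G (q y).
  pose p y := if pselect (near_top y) is left _ then 0%N else (q y).+1.
  have p0 y : near_top y -> p y = 0%N by rewrite /p; case: pselect.
  have pS y : ~ near_top y -> p y = (q y).+1 by rewrite /p; case: pselect.
  have [_ lq A0 AF _] := cA.
  have nA' : nbhs x0 [set y | A y -> near_top y].
    apply: filterS (AF _ FG) => y h Ay; have [->|yx0] := pselect (y = x0).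
      by left.
    by right; exact: h.
  have lp : locconst A p.
    move=> x Ax; have [->|xx0] := pselect (x = x0).
      by apply: filterS nA' => y h /h/p0 ->; rewrite p0//; left.
    have A'x : (A `\ x0) x by [].
    apply: filterS2 (A0 _ A'x) (lq _ A'x) => y /= yx0 h Ay.
    have qy : q y = q x by exact: h.
    have [ty|nty] := pselect (near_top y).
      by rewrite !p0//; right; case: ty; rewrite -?qy.
    by rewrite !pS ?qy// => -[//|]; rewrite -qy => Gy; apply: nty; right.
  apply: (decomposable_sum (I := nat) 0%N lp) => -[|n]; last first.
    apply: (dn n) => y [Ay]; have [/p0 ->//|ny] := pselect (near_top y).
    rewrite pS// => -[qy]; do !split=> //.
    by move=> yx0; apply: ny; left.
  set A' := piece A p 0%N.
  have tA' y : A' y -> near_top y.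
    move=> [_]; apply: contra_eqP => ny; apply/eqP.
    by rewrite pS.
  have A'x0 : A' x0 by split=> //; rewrite p0//; left.
  have cA' : cone F A' x0 q by apply: cone_sub cA => //; exact: piece_sub.
  have sub' n : piece (A' `\ x0) q n `<=` piece (A `\ x0) q n.
    by move=> y [[[Ay _] yx0] qy].
  apply: (@decomposable_nlimit _ _ _ _ _ _ _ c).
    by move=> /limit_succ/(_ cg).
  apply: (cone_decomposable_T cg (sub_countable_ord ga ca) cA').
  + move=> n; apply: (dn n); apply: subset_trans (sub' n) _.
    by move=> y [[_ yx0] qy].
  + apply: cb_locS gx0; apply: filterS nA' => y h Ay.
    by split=> //; rewrite p0//; exact: h.
  + move=> n; have [Gn|nGn] := pselect (G n).
      exact: cb_sub_eq0 (sub' n) (Gg _ Gn).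
    apply: (@cb_sub_eq0 _ _ _ _ _ set0); last first.
      by rewrite -subset0; exact: cb_sub.
    by move=> y [[/tA'[//|Gy] _] qy]; apply: nGn; rewrite -qy.
- have [q [lq qa qT]] := T_limit wf FF la.
  have /countable_injP[f finj] := ca.
  apply: (decomposable_sum (I := nat) 0%N (p := f \o q)).
    by apply: locconst_comp; apply: locconst_sub lq; exact: subsetT.
  move=> i; have [[b ba fb]|nb] := pselect (exists2 b, b < a & f b = i).
    apply: decomposable_sub_T (qT b ba) (IH' _ ba) _ => x [_ /= fx]; split=> //.
    by apply: finj; rewrite ?inE //= ?qa// fb.
  apply: (decomposable0 _ _ a); rewrite predeqE => x; split=> // -[_ /= fx].
  by apply: nb; exists (q x).
Qed.

Theorem homeo_T a (A : set (T a)) : countable [set b : O | b < a] ->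
  rk A a -> A ~= [set: T a].
Proof.
move=> ca rA; have dA := decomposable_subspace A ca.
have [mA lA] := classification F_homogeneous F_times ca dA rA.
case: (ord_cases a) => [za|[b ab]|/lA//].
  by apply: homeo0; [exact: rk_zero rA|exact: T_zero].
have [x0 Tb] := T_top wf FF ab.
apply: (sum_of_copies_single (x0 := x0) ab mA).
have sA : cb A b `<=` [set x0] by rewrite -Tb; exact: cbS.
have [x bx] := rA.2 _ (succ_lt ab).
by apply/seteqP; split=> // _ ->; have /= <- := sA _ bx.
Qed.

Theorem homeo_copies a b (A : set (T a)) : countable [set b : O | b < a] ->
  b < a -> rk A b ->
  exists C : set nat, A ~= [set: ({_ : C & T b} : topologicalType)].
Proof.
move=> ca ba rA; have cb := sub_countable_ord ba ca.
have [[q lq qT] _] :=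
  classification F_homogeneous F_times cb (decomposable_subspace A ca) rA.
exists [set i | piece A q i !=set0]; set C := [set _ | _].
pose p (w : {_ : C & T b}) : nat := set_val (projT1 w).
have lp : locconst [set: {_ : C & T b}] p.
  exact: (locconst_comp set_val (@sigT_locconst _ _)).
apply: (homeo_glue lq lp) => i; have [Ci|nCi] := pselect (C i).
  pose i' : C := SigSub (mem_set Ci).
  have -> : piece [set: {_ : C & T b}] p i = piece setT (@projT1 _ _) i'.
    rewrite predeqE => w; split=> -[_ e]; split=> //.
      by apply: val_inj.
    by rewrite /p e.
  apply: homeo_trans (homeo_sym (sigT_piece (fun=> T b) i')).
  by have [p0|//] := qT i; have [x] := Ci; rewrite p0.
apply: homeo0.
  by apply/eqP/negPn/negP => /set0P.
rewrite predeqE => w; split=> // -[_ wi]; apply: nCi; rewrite -wi.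
exact: set_valP.
Qed.

End toronto_theorem.

Theorem theorem2p11 (F : set_system nat) (FF : ProperFilter F)
    (F_homogeneous : homogeneous_filter F)
    (F_times : filter_iso setT F setT (filter_times_omega F))
    (F_finite_to_one : finite_to_one_property F)
    (d : Order.disp_t) (O : orderType d)
    (wf : well_founded (fun x y : O => (x < y)%O))
    (a : O) (a_lt_omega1 : countable [set b : O | (b < a)%O]) :
  [/\ countable [set: toronto_space wf FF a],
      toronto wf a (toronto_space wf FF a) &
      forall (b : O) (A : set (toronto_space wf FF a)),
        (b < a)%O -> has_rank wf (A : topologicalType) b ->
        exists C : set nat,
          homeomorphic (A : topologicalType)
            ({_ : C & toronto_space wf FF b} : topologicalType)].
Proof.
have rkA (A : set (toronto_space wf FF a)) b :
    has_rank wf (A : topologicalType) b -> rk wf A b.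
  by move=> /has_rankE; apply: homeo_rk; exact: homeo_set_type.
split; first exact: countable_T.
  split; last 1 first.
  - move=> A /rkA rA; apply: homeo_homeomorphic.
    apply: homeo_trans (homeo_sym (homeo_set_type A)); apply: homeo_sym.
    exact: homeo_T.
  - by exists a; rewrite cb_derivativeE; exact: (rk_T wf FF a).1.
  - by apply/has_rankE; exact: rk_T.
move=> b A ba /rkA rA.
have [C AC] :=
  homeo_copies F_homogeneous F_times F_finite_to_one a_lt_omega1 ba rA.
exists C; apply: homeo_homeomorphic; apply: homeo_trans AC.
exact: homeo_set_type.
Qed.
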